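(* Let $m\ge1$ and $\mu_1,\mu_2\in\mathbb C\setminus\{0\}$. The variety $D_{2,m}(\mu_1,\mu_2)$ is isomorphic to the transverse Hilbert scheme $\bigl(D_{2,1}(\mu_1,\mu_2)\bigr)^{[m]}_\pi$ of $m$ points on the deformation of the $D_2$-singularity defined by the equation $$a^2-xc^2+\tfrac14x+(\mu_1^2-\mu_2^2)c-\tfrac12(\mu_1^2+\mu_2^2)=0$$ in $\mathbb C^3$, with $\pi(a,c,x)=x$.
   Context: $\mathcal S_n$ is the set of $n\times n$ companion matrices, i.e. complex matrices with all subdiagonal entries equal to $1$, arbitrary last column, and all other entries zero. For $n=2m$ let $\mathcal O_i\subset\mathfrak{gl}(2m,\mathbb C)$ ($i=1,2$) be the $GL(2m,\mathbb C)$-orbit of semisimple matrices with eigenvalues $\mu_i$ and $-\mu_i$, each of multiplicity $m$. Then $D_{2,m}(\mu_1,\mu_2)=\{(A,B)\in\mathcal O_1\times\mathcal O_2;\ A+B\in\mathcal S_{2m}\}$. The surface $D_{2,1}(\mu_1,\mu_2)$ is identified with the affine surface given in the claim. For a complex manifold $X$ and a surjective holomorphic map $\pi:X\to C$ to a $1$-dimensional complex manifold, the transverse Hilbert scheme $X^{[m]}_\pi$ is the open subset of the Hilbert scheme $X^{[m]}$ of $m$ points consisting of those $0$-dimensional subschemes $Z$ of length $m$ for which $\pi:Z\to\pi(Z)$ is an isomorphism onto the scheme-theoretic image. *)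

(* Defs.v *)
From HB Require Import structures.
From mathcomp Require Import all_boot all_order all_algebra.
From mathcomp Require Import boolp classical_sets functions reals complex mpoly.

Set Implicit Arguments.
Unset Strict Implicit.
Unset Printing Implicit Defensive.

Import GRing.Theory.
Local Open Scope ring_scope.
Local Open Scope classical_set_scope.

(* Varieties over k are handled through their functors of points on
   commutative k-algebras A; by the Yoneda lemma a bijection natural in A
   between two such functors is an isomorphism of the schemes they define.
   The lemmas orbit_points_base, D2_points_base and
   transverse_hilbert_points_base give the k-points in classical terms. *)

(* f_0, ..., f_(r-1) generate the unit ideal of A, i.e. the principal opens
   Spec A[1/f_i] cover Spec A. *)
Definition comaximal (A : comNzRingType) (r : nat) (f : 'I_r -> A) : Prop :=
  exists h : 'I_r -> A, \sum_i h i * f i = 1.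

Section MatrixSide.

Variable k : fieldType.

Definition diag_pm (A : comAlgType k) (m : nat) (mu : k) : 'M[A]_(m + m) :=
  block_mx (mu%:A)%:M 0 0 (- mu%:A)%:M.

Definition orbit (n : nat) (D : 'M[k]_n) : set 'M[k]_n :=
  [set M | exists2 g, g \in unitmx & M = g *m D *m invmx g].

(* A-points of the orbit O(mu) of diag(mu, ..., mu, -mu, ..., -mu), seen as a
   homogeneous space of GL(2m).  The stabiliser GL(m) x GL(m) has only Zariski
   locally trivial torsors, so an A-point is a matrix over A which, over each
   piece A[1/f_i] of a Zariski cover of Spec A, is conjugate to the diagonal
   matrix.  The conjugating matrix over A[1/f_i] is P_i; its inverse is
   Q_i / f_i once denominators are cleared. *)
Definition orbit_points (A : comAlgType k) (m : nat) (mu : k) :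
    set 'M[A]_(m + m) :=
  [set M | exists (r : nat) (f : 'I_r -> A) (P Q : 'I_r -> 'M[A]_(m + m)),
     comaximal f /\
     forall i, P i *m Q i = (f i)%:M /\ M *m P i = P i *m diag_pm A m mu].

Definition companion (A : comAlgType k) (n : nat) : set 'M[A]_n :=
  [set S | forall i j : 'I_n, (j.+1 < n)%N -> S i j = (i == j.+1 :> nat)%:R].

Definition D2_points (m : nat) (mu1 mu2 : k) (A : comAlgType k) :
    set ('M[A]_(m + m) * 'M[A]_(m + m)) :=
  [set M | [/\ orbit_points mu1 M.1, orbit_points mu2 M.2
             & companion (M.1 + M.2)]].

End MatrixSide.

Definition map_pair_mx (A B : nzRingType) (f : A -> B) (n : nat)
    (M : 'M[A]_n * 'M[A]_n) : 'M[B]_n * 'M[B]_n :=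
  (map_mx f M.1, map_mx f M.2).

Definition is_ideal (S : comNzRingType) (I : set S) : Prop :=
  [/\ I 0, forall p q, I p -> I q -> I (p + q) & forall p q, I q -> I (p * q)].

(* A[X_0, ..., X_(n-1)] / I is a locally free A-module of rank m: on each piece
   Spec A[1/f_i] of a Zariski cover it is free, with basis the classes of
   e_i0, ..., e_i(m-1).  Both clauses are the statements over A[1/f_i] with
   denominators cleared. *)
Definition locally_free_quotient (n m : nat) (A : comNzRingType)
    (I : set {mpoly A[n]}) : Prop :=
  exists (r : nat) (f : 'I_r -> A) (e : 'I_r -> 'I_m -> {mpoly A[n]}),
    comaximal f /\
    forall i,
      (forall p, exists (N : nat) (c : 'I_m -> A),
         I (f i ^+ N *: p - \sum_j c j *: e i j)) /\
      (forall c : 'I_m -> A, I (\sum_j c j *: e i j) ->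
         exists N : nat, forall j, f i ^+ N * c j = 0).

(* The ideal of the base change of V(I) along Spec B -> Spec A. *)
Definition base_change (n : nat) (A B : comNzRingType) (f : A -> B)
    (I : set {mpoly A[n]}) : set {mpoly B[n]} :=
  smallest (@is_ideal {mpoly B[n]}) [set map_mpoly f p | p in I].

(* For Z = V(I) over a field K and a regular function pi, the scheme-theoretic
   image pi(Z) in the affine line is Spec K[t]/J, where J is the kernel of
   K[t] -> O(Z), q |-> q(pi).  Hence pi : Z -> pi(Z) is an isomorphism iff the
   always injective map K[t]/J -> O(Z) is onto. *)
Definition transverse (n : nat) (K : fieldType) (pi : {mpoly K[n]})
    (I : set {mpoly K[n]}) : Prop :=
  forall p : {mpoly K[n]}, exists q : {poly K},
    I (p - (map_poly (@mpolyC n K) q).[pi]).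

Section HilbertSide.

Variables (k : fieldType) (n : nat).

(* A-points of the Hilbert scheme of m points of the affine hypersurface F = 0:
   closed subschemes of the base change of the hypersurface to A that are
   finite and locally free of rank m over A. *)
Definition hilbert_points (F : {mpoly k[n]}) (m : nat) (A : comAlgType k) :
    set (set {mpoly A[n]}) :=
  [set I | [/\ is_ideal I, I (map_mpoly (in_alg A) F)
             & locally_free_quotient m I]].

(* An A-point lies in the open subscheme of transverse subschemes iff its fibre
   at every field-valued point s : Spec K -> Spec A does. *)
Definition transverse_hilbert_points (F pi : {mpoly k[n]}) (m : nat)
    (A : comAlgType k) : set (set {mpoly A[n]}) :=
  [set I | hilbert_points F m I /\
     forall (K : fieldType) (s : {rmorphism A -> K}),
       transverse (map_mpoly (s \o in_alg A) pi) (base_change s I)].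

End HilbertSide.

Section Surface.

Variable k : fieldType.

Definition Xa : {mpoly k[3]} := 'X_(@Ordinal 3 0 isT).
Definition Xc : {mpoly k[3]} := 'X_(@Ordinal 3 1 isT).
Definition Xx : {mpoly k[3]} := 'X_(@Ordinal 3 2 isT).

Definition D2_surface (mu1 mu2 : k) : {mpoly k[3]} :=
  Xa ^+ 2 - Xx * Xc ^+ 2 + 4^-1 *: Xx + (mu1 ^+ 2 - mu2 ^+ 2) *: Xc
  - (2^-1 * (mu1 ^+ 2 + mu2 ^+ 2))%:MP.

End Surface.

Section BasePoints.

Variable k : fieldType.

Lemma comaximal_field (r : nat) (f : 'I_r -> k) :
  comaximal f -> exists i, f i != 0.
Proof.
move=> [h hf]; apply: contrapT => nf; move: hf.
rewrite big1 => [/esym/eqP|i _]; first by rewrite oner_eq0.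
have [->|fi0] := eqVneq (f i) 0; first by rewrite mulr0.
by case: nf; exists i.
Qed.

Lemma orbit_points_base (m : nat) (mu : k) :
  @orbit_points k k^o m mu = orbit (@diag_pm k k^o m mu).
Proof.
apply/seteqP; split=> M /=.
- move=> [r [f [P [Q [/comaximal_field [i fi0] PQ]]]]].
  have [PQi MP] := PQ i.
  have Pu : P i \in unitmx.
    have : P i *m ((f i)^-1 *: Q i) = 1%:M.
      by rewrite -scalemxAr PQi scale_scalar_mx mulVf.
    by case/mulmx1_unit.
  by exists (P i) => //; rewrite -MP mulmxK.
- move=> [g gu ->]; exists 1, (fun=> 1), (fun=> g), (fun=> invmx g); split.
    by exists (fun=> 1); rewrite big_ord1 mulr1.
  by move=> i; rewrite mulmxV // mulmxKV.
Qed.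

Lemma D2_points_base (m : nat) (mu1 mu2 : k) :
  @D2_points k m mu1 mu2 k^o =
  [set M | [/\ orbit (@diag_pm k k^o m mu1) M.1,
               orbit (@diag_pm k k^o m mu2) M.2
             & @companion k k^o (m + m) (M.1 + M.2)]].
Proof. by rewrite /D2_points !orbit_points_base. Qed.

Lemma is_ideal_sum (S : comNzRingType) (I : set S) (T : Type) (s : seq T)
    (F : T -> S) :
  is_ideal I -> (forall i, I (F i)) -> I (\sum_(i <- s) F i).
Proof. by move=> [I0 ID _] IF; apply: big_ind. Qed.

Lemma base_change_ideal (n : nat) (A B : comNzRingType) (f : A -> B)
    (I : set {mpoly A[n]}) : is_ideal (base_change f I).
Proof.
split=> [J [[]]|p q Ip Iq J JP|p q Iq J JP] //.
- by case: (JP) => -[_ JD _] _; apply: JD; [apply: Ip|apply: Iq].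
- by case: (JP) => -[_ _ JM] _; apply: JM; apply: Iq.
Qed.

Lemma locally_free_quotient_field (n m : nat) (I : set {mpoly k[n]}) :
  is_ideal I ->
  locally_free_quotient m I <->
  exists e : 'I_m -> {mpoly k[n]},
    (forall p, exists c : 'I_m -> k, I (p - \sum_j c j *: e j)) /\
    (forall c : 'I_m -> k, I (\sum_j c j *: e j) -> forall j, c j = 0).
Proof.
move=> [_ _ IM]; split.
- move=> [r [f [e [/comaximal_field [i fi0] /(_ i) [sp fr]]]]].
  exists (e i); split=> [p|c /fr [N cN] j].
    have [N [c Hc]] := sp p.
    exists (fun j => (f i ^+ N)^-1 * c j).
    have := IM ((f i ^+ N)^-1)%:MP _ Hc.
    rewrite mul_mpolyC scalerBr scalerA mulVf ?expf_neq0 // scale1r.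
    by rewrite scaler_sumr; under eq_bigr do rewrite scalerA.
  by have /eqP := cN j; rewrite mulf_eq0 expf_eq0 (negPf fi0) andbF => /eqP.
- move=> [e [sp fr]]; exists 1, (fun=> 1), (fun=> e); split.
    by exists (fun=> 1); rewrite big_ord1 mulr1.
  move=> _; split=> [p|c /fr c0].
    by have [c Hc] := sp p; exists 0, c; rewrite expr0 scale1r.
  by exists 0 => j; rewrite expr0 mul1r c0.
Qed.

Lemma map_mpoly_id (n : nat) (p : {mpoly k[n]}) :
  map_mpoly (idfun : k -> k) p = p.
Proof. by apply/mpolyP => u; rewrite (mcoeff_map_mpoly idfun). Qed.

Lemma transverse_base_change (n : nat) (pi : {mpoly k[n]})
    (I : set {mpoly k[n]}) (K : fieldType) (s : {rmorphism k -> K}) :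
  transverse pi I -> transverse (map_mpoly s pi) (base_change s I).
Proof.
move=> T p.
have [q Hq] := choice (fun u : 'X_{1..n} => T 'X_[u]).
exists (\sum_(u <- msupp p) p@_u *: map_poly s (q u)).
rewrite {1}[p]mpolyE raddf_sum horner_sum -sumrB.
apply: (is_ideal_sum _ (base_change_ideal s I)) => u.
have [_ _ JM] := base_change_ideal s I.
have Ju : base_change s I (map_mpoly s
    ('X_[u] - (map_poly (@mpolyC n k) (q u)).[pi])).
  move=> J [_ sJ]; apply: sJ.
  by exists ('X_[u] - (map_poly (@mpolyC n k) (q u)).[pi]).
have := JM (p@_u)%:MP _ Ju.
rewrite rmorphB /= map_mpolyX mul_mpolyC scalerBr.
suff -> : (map_poly (@mpolyC n K) (p@_u *: map_poly s (q u))).[map_mpoly s pi]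
   = p@_u *: map_mpoly s (map_poly (@mpolyC n k) (q u)).[pi] by [].
rewrite -mul_polyC rmorphM /= map_polyC /= hornerM hornerC mul_mpolyC.
rewrite -horner_map /= -!map_poly_comp; congr (_ *: _.[_]).
by apply: eq_map_poly => x /=; rewrite map_mpolyC.
Qed.

Lemma transverse_hilbert_points_base (n m : nat) (F pi : {mpoly k[n]}) :
  @transverse_hilbert_points k n F pi m k^o =
  [set I : set {mpoly k[n]} | [/\ is_ideal I, I F,
     exists e : 'I_m -> {mpoly k[n]},
       (forall p, exists c : 'I_m -> k, I (p - \sum_j c j *: e j)) /\
       (forall c : 'I_m -> k, I (\sum_j c j *: e j) -> forall j, c j = 0)
   & transverse pi I]].
Proof.
have inalgE : (in_alg k^o : k -> k) = idfun.
  by apply/funext => x; apply: mulr1.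
have map_in_alg (p : {mpoly k[n]}) : map_mpoly (in_alg k^o) p = p.
  exact: etrans (congr1 (fun g : k -> k => map_mpoly g p) inalgE)
    (map_mpoly_id p).
apply/seteqP; split=> I /=.
- move=> -[[II IF LF] T]; split.
  + exact: II.
  + exact: (eq_ind _ I IF _ (map_in_alg F)).
  + exact: (proj1 (@locally_free_quotient_field n m I II) LF).
  + have Tk : transverse pi (base_change (idfun : k -> k) I).
      exact: (eq_ind _ (fun g => transverse g _) (T k idfun) _ (map_in_alg pi)).
    move=> p; have [q Hq] := Tk p; exists q; apply: Hq; split.
      exact: II.
    by move=> _ [u Iu <-]; rewrite map_mpoly_id.
- move=> [II IF LF T]; split; first split.
  + exact: II.
  + exact: (eq_ind_r I IF (map_in_alg F)).
  + exact: (proj2 (@locally_free_quotient_field n m I II) LF).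
  + move=> K s.
    have E : map_mpoly (s \o in_alg k^o) pi = map_mpoly (s : k -> K) pi.
      exact: (congr1 (fun g : k -> k => map_mpoly ((s : k -> K) \o g) pi) inalgE).
    apply: (eq_ind_r (fun g => transverse g _) _ E).
    exact: (@transverse_base_change n pi I K (s : {rmorphism k -> K}) T).
Qed.

End BasePoints.

(* Main.v *)
Require Import Defs.
From HB Require Import structures.
From mathcomp Require Import all_boot all_order all_algebra all_fingroup.
From mathcomp Require Import generic_quotient ring_quotient.
From mathcomp Require Import ssrcomplements.
From mathcomp Require Import boolp classical_sets functions reals complex mpoly.
From mathcomp Require Import ring zify.

Set Implicit Arguments.
Unset Strict Implicit.
Unset Printing Implicit Defensive.

Import GRing.Theory.
Import Pdiv.CommonRing Pdiv.RingMonic.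
Local Open Scope ring_scope.
Local Open Scope classical_set_scope.

(** Over a commutative k-algebra A, with k of characteristic 0, both functors
    have as points the triples (Q, al, ga) of polynomials over A, where Q is
    monic of degree m, al and ga have degree less than m, and Q divides the
    equation of the surface evaluated at (a, c, x) = (al, ga, 'X).  The
    isomorphism and its inverse go through these triples.

    On the side of the surface, transversality says that on the fibre over
    each field-valued point of Spec A the function x generates the ring of
    functions.  In a local basis of the quotient, the determinant of the powers
    1, x, ..., x ^ (m - 1) then vanishes at no field-valued point, so these
    powers are a basis over all of A (transverse_power_basis).  The expansions
    of x ^ m, a and c in this basis are Q, al and ga, and the subscheme is the
    graph of x |-> (al x, ga x) over Q = 0 (transverse_graph_ideal).

    On the side of the matrices, a point of the orbit of
    diag(mu, ..., mu, -mu, ..., -mu) is a matrix M with M ^ 2 = mu ^ 2 and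
    trace 0 (orbit_points_sqr_tr, sqr_tr_orbit_points): the trace fixes the
    rank of the idempotent (mu - M) / (2 mu), and minors of this idempotent
    that sum to 1 give a Zariski cover with explicit eigenbases.  For a pair
    (M, N), put S = M + N.  Then S ^ 2 commutes with M and N, and cycling words
    in M and N under the trace gives tr (S ^ t) = 0 for odd t.  By Newton's
    identities the characteristic polynomial of the companion matrix S is even,
    say Q (s ^ 2) (companion_coef_odd).  The first basis vector e being cyclic
    for S, the free module of rank 2m becomes free of rank 2 over A[z] / Q, with
    z = S ^ 2 and basis e, S e.  The relation M S + S M = S ^ 2 + mu1 ^ 2 -
    mu2 ^ 2 determines M from its first column M e = al (z) e + be (z) S e: it
    is the 2 x 2 matrix with rows (al, z + mu1 ^ 2 - mu2 ^ 2 - z be) and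
    (be, - al).  The square of this matrix is scalar, and it equals mu1 ^ 2
    exactly when Q divides the equation of the surface at (al, be - 1/2, z)
    (pair_block_sqr, D2_normal_form, restrict_pair_D2). *)

(** * Field-valued points and Zariski covers *)

Section MaximalIdeal.

Variables (A : comNzRingType) (I : set A).
Hypotheses (II : is_ideal I) (nI1 : ~ I 1).

(** Zorn's lemma is applied to the sets whose union with I is a proper ideal:
    adjoining I makes the empty union an upper bound of the empty chain. *)
Lemma maximal_ideal_exists :
  exists M : set A, [/\ is_ideal M, ~ M 1, I `<=` M &
    forall x, ~ M x -> exists y, M (1 - y * x)].
Proof.
pose P (X : set A) := is_ideal (X `|` I) /\ ~ (X `|` I) 1.
have [F FP Ftot|X [[XI X1] Xmax]] := @Zorn_bigcup A P.
  have [I0 ID IM] := II.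
  split; last by case=> // -[X FX X1]; have [_] := FP _ FX; apply; left.
  split; first by right.
    have FD (X Y : set A) p q : F X -> F Y -> X p -> Y q ->
        ((\bigcup_(Z in F) Z) `|` I) (p + q).
      move=> FX FY Xp Yq.
      have [XY|YX] := Ftot _ _ FX FY.
        have [[_ D _] _] := FP _ FY.
        have [|] := D p q (or_introl (XY _ Xp)) (or_introl Yq); last by right.
        by left; exists Y.
      have [[_ D _] _] := FP _ FX.
      have [|] := D p q (or_introl Xp) (or_introl (YX _ Yq)); last by right.
      by left; exists X.
    move=> p q [[X FX Xp]|Ip] [[Y FY Yq]|Iq].
    - exact: (FD X Y).
    - have [[_ D _] _] := FP _ FX.
      have [|] := D p q (or_introl Xp) (or_intror Iq); last by right.
      by left; exists X.
    - have [[_ D _] _] := FP _ FY.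
      have [|] := D p q (or_intror Ip) (or_introl Yq); last by right.
      by left; exists Y.
    - by right; apply: ID.
  move=> p q [[X FX Xq]|Iq]; last by right; apply: IM.
  have [[_ _ M] _] := FP _ FX.
  by have [|] := M p q (or_introl Xq); [left; exists X | right].
have [M0 MD MM] := XI.
exists (X `|` I); split; [by [] | by [] | by move=> x Ix; right | move=> x nMx].
(* B is the ideal generated by the maximal element and x. *)
pose B : set A := [set z | exists2 y, (X `|` I) y & exists w, z = y + w * x].
apply: contrapT => ny.
have BI : is_ideal B.
  split.
  - by exists 0 => //; exists 0; rewrite mul0r addr0.
  - move=> _ _ [y My [w ->]] [y' My' [w' ->]].
    by exists (y + y'); [exact: MD | exists (w + w'); ring].
  - move=> p _ [y My [w ->]].
    by exists (p * y); [exact: MM | exists (p * w); ring].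
have MB : X `|` I `<=` B by move=> y My; exists y => //; exists 0; ring.
have IB : I `<=` B by move=> y Iy; apply: MB; right.
have EB : B `|` I = B by apply/seteqP; split=> y; [case=> // /IB | left].
apply: (Xmax B).
  split=> [y Xy|E]; first by apply: MB; left.
  by apply: nMx; left; apply: E; exists 0 => //; exists 1; ring.
rewrite /P EB; split=> // -[y My [w yw]]; apply: ny; exists w.
by rewrite yw addrK.
Qed.

End MaximalIdeal.

Section ResidueField.

Local Open Scope quotient_scope.

Variables (A : comNzRingType) (M : set A).
Hypotheses (MI : is_ideal M) (nM1 : ~ M 1).
Hypothesis Mmax : forall x, ~ M x -> exists y, M (1 - y * x).

Definition ideal_pred : A -> bool := fun x => `[< M x >].

Fact ideal_pred_closed : idealr_closed ideal_pred.
Proof.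
have [M0 MD MM] := MI.
split; rewrite ?unfold_in; [exact/asboolP | exact/asboolP |].
move=> a u v; rewrite !unfold_in => /asboolP Mu /asboolP Mv.
by apply/asboolP; apply: MD => //; apply: MM.
Qed.

HB.instance Definition _ := isIdealr.Build A ideal_pred ideal_pred_closed.

Definition residue_ideal : idealr A := Idealr.clone A ideal_pred _.

Definition residue : Type := Quotient.quot residue_ideal.
HB.instance Definition _ := GRing.ComNzRing.on residue.

Definition residue_map (x : A) : residue := \pi_(Quotient.quot residue_ideal) x.

Fact residue_map_zmod : zmod_morphism residue_map.
Proof. by move=> x y; rewrite /residue_map !piE. Qed.

Fact residue_map_monoid : monoid_morphism residue_map.
Proof. by split=> [|x y]; rewrite /residue_map !piE. Qed.

HB.instance Definition _ :=
  GRing.isZmodMorphism.Build A residue residue_map residue_map_zmod.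
HB.instance Definition _ :=
  GRing.isMonoidMorphism.Build A residue residue_map residue_map_monoid.

Lemma residue_map_eq0 x : (residue_map x == 0) = `[< M x >].
Proof.
rewrite -(rmorph0 residue_map) /residue_map.
by rewrite -Quotient.idealrBE subr0.
Qed.

Definition residue_inv (x : residue) : residue :=
  if x == 0 then 0 else xget 0 [set y | y * x = 1].

Fact residue_mulV (x : residue) : x != 0 -> residue_inv x * x = 1.
Proof.
move=> x0; rewrite /residue_inv (negPf x0).
suff xV : [set y | y * x = 1] !=set0 by have := xgetPex 0 xV.
have [a xE] : exists a, x = residue_map a.
  by exists (repr x); rewrite /residue_map reprK.
move: x0; rewrite xE residue_map_eq0 => /asboolPn /Mmax [y My].
exists (residue_map y); rewrite /= -rmorphM -(rmorph1 residue_map).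
apply/esym/eqP; rewrite -subr_eq0 -rmorphB residue_map_eq0.
exact/asboolP.
Qed.

Fact residue_inv0 : residue_inv 0 = 0.
Proof. by rewrite /residue_inv eqxx. Qed.

HB.instance Definition _ :=
  GRing.ComNzRing_isField.Build residue residue_mulV residue_inv0.

Lemma residue_field_point :
  exists (K : fieldType) (s : {rmorphism A -> K}), forall x, M x -> s x = 0.
Proof.
exists (residue : fieldType), residue_map => x Mx.
by apply/eqP; rewrite residue_map_eq0; apply/asboolP.
Qed.

End ResidueField.

(** A family of elements generates the unit ideal as soon as it has no common
    zero at field-valued points: this is how properties of fibres become
    identities over A. *)
Lemma proper_ideal_field_point (A : comNzRingType) (I : set A) :
  is_ideal I -> ~ I 1 ->
  exists (K : fieldType) (s : {rmorphism A -> K}), forall x, I x -> s x = 0.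
Proof.
move=> II nI1; have [M [MI nM1 IM Mmax]] := maximal_ideal_exists II nI1.
have [K [s sM]] := residue_field_point MI nM1 Mmax.
by exists K, s => x /IM /sM.
Qed.

(** A field-valued point that kills I kills every f_i, hence also their
    combination 1. *)
Lemma comaximal_ideal1 (A : comNzRingType) (r : nat) (f : 'I_r -> A)
    (I : set A) :
  is_ideal I -> comaximal f -> (forall i, exists N, I (f i ^+ N)) -> I 1.
Proof.
move=> II [h hf] If; apply: contrapT => nI1.
have [K [s sI]] := proper_ideal_field_point II nI1.
have sf i : s (f i) = 0.
  have [N /sI /eqP] := If i.
  by rewrite rmorphXn expf_eq0 => /andP[_ /eqP].
have /eqP := congr1 s hf; rewrite rmorph1 rmorph_sum big1 /=.
  by rewrite eq_sym oner_eq0.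
by move=> i _; rewrite rmorphM sf mulr0.
Qed.

(** Membership in a submodule is local on a Zariski cover: the scalars that
    carry v into L form an ideal containing a power of each f_i. *)
Lemma comaximal_submodule (A : comNzRingType) (V : lmodType A) (L : set V)
    (r : nat) (f : 'I_r -> A) (v : V) :
  L 0 -> (forall u w, L u -> L w -> L (u + w)) ->
  (forall (a : A) u, L u -> L (a *: u)) ->
  comaximal f -> (forall i, exists N, L (f i ^+ N *: v)) -> L v.
Proof.
move=> L0 LD LZ cf Lf; rewrite -(scale1r v).
apply: (@comaximal_ideal1 A r f [set a | L (a *: v)]) => //.
split=> [|p q|p q] /=; rewrite ?scale0r ?scalerDl -?scalerA //; first exact: LD.
exact: LZ.
Qed.

(** * Determinants of idempotent pencils *)

Lemma deriv_prod (R : comNzRingType) (I : finType) (F : I -> {poly R}) :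
  (\prod_i F i)^`() = \sum_i (F i)^`() * \prod_(j | i != j) F j.
Proof.
have E (s : seq I) : uniq s ->
  (\prod_(i <- s) F i)^`() =
  \sum_(i <- s) (F i)^`() * \prod_(j <- s | i != j) F j.
  elim: s => [|x s IHs] /=; first by rewrite !big_nil derivC.
  case/andP=> xs us; rewrite !big_cons derivM IHs // eqxx /=; congr (_ * _ + _).
    rewrite big_seq [RHS]big_seq_cond; apply: eq_bigl => j.
    by rewrite andbC; case: eqVneq => [<-|]; rewrite ?(negPf xs) ?andbT.
  rewrite mulr_sumr big_seq [RHS]big_seq; apply: eq_bigr => i is_.
  rewrite big_cons ifT; first by rewrite mulrCA.
  by apply: contraNneq xs => <-.
by rewrite E // index_enum_uniq.
Qed.

(** Jacobi's formula.  Differentiating the Leibniz expansion one row at a time,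
    the terms in which the entry (i, j) is differentiated add up to its
    cofactor. *)
Lemma deriv_det (R : comNzRingType) (n : nat) (N : 'M[{poly R}]_n) :
  (\det N)^`() = \tr (\adj N *m map_mx (@deriv R) N).
Proof.
rewrite /determinant raddf_sum /= /mxtrace.
under [RHS]eq_bigr => j _ do rewrite mxE.
rewrite exchange_big /=.
transitivity (\sum_i \sum_(s : 'S_n)
    (N i (s i))^`() * ((-1) ^+ s * \prod_(k | i != k) N k (s k))).
  rewrite exchange_big /=; apply: eq_bigr => s _.
  have -> : (-1) ^+ s = ((-1) ^+ s)%:P :> {poly R}.
    by rewrite rmorphXn rmorphN1.
  rewrite derivM deriv_prod derivC mul0r add0r mulr_sumr.
  by apply: eq_bigr => i _; rewrite mulrCA.
apply: eq_bigr => i _.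
rewrite (partition_big (fun s : 'S_n => s i) predT) //=.
apply: eq_bigr => j _; rewrite !mxE expand_cofactor mulr_suml.
by apply: eq_bigr => s /eqP ->; rewrite mulrC.
Qed.

Definition natr_torsion_free (A : nzRingType) :=
  forall (y : A) j, y *+ j.+1 = 0 -> y = 0.

Section IdempotentPencil.

Variables (A : comNzRingType) (n m : nat) (e : 'M[A]_n).
Hypothesis torsA : natr_torsion_free A.
Hypotheses (ee : e *m e = e) (tre : \tr e = m%:R).

Let E := map_mx (@polyC A) e.
Let N := (1%:M - E) + 'X *: E.

(** Over a field this says that an idempotent of trace m has rank m.  The pencil
    N has 'X * (1 - e) + e as an inverse up to the factor 'X, so Jacobi's
    formula becomes the Euler equation 'X * D' = m D for D = \det N.  Without
    torsion its solutions are the multiples of 'X^m, and D is 1 at 1. *)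
Lemma det_idempotent_pencil : \det N = 'X^m.
Proof.
have EE : E *m E = E by rewrite /E -map_mxM ee.
have XD : 'X * (\det N)^`() = \det N *+ m.
  have dN : map_mx (@deriv A) N = E.
    apply/matrixP => i j.
    by rewrite !mxE !derivE mul0rn mul1r mulr0 subr0 add0r addr0.
  have CE : (1%:M - E) *m E = 0 by rewrite mulmxBl mul1mx EE subrr.
  have XE : ('X *: (1%:M - E) + E) *m E = E.
    by rewrite mulmxDl -scalemxAl CE scaler0 add0r EE.
  have NE : N *m ('X *: (1%:M - E) + E) = 'X *: 1%:M.
    rewrite mulmxDr -scalemxAr mulmxBr mulmx1 {}/N.
    have -> : (1%:M - E + 'X *: E) *m E = 'X *: E.
      by rewrite mulmxDl CE add0r -scalemxAl EE.
    by rewrite -scalerDr addrK subrK.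
  rewrite deriv_det dN -mxtraceZ scalemxAr -{1}[E]mul1mx scalemxAl -NE.
  rewrite -(mulmxA N) XE mulmxA mul_adj_mx mul_scalar_mx mxtraceZ -mulr_natr.
  by congr (_ * _); rewrite trace_map_mx tre rmorph_nat.
have D1 : (\det N).[1] = 1.
  rewrite -[LHS]/(horner_eval 1 (\det N)) -det_map_mx.
  rewrite (_ : map_mx _ _ = 1%:M) ?det1 //.
  apply/matrixP => i j.
  rewrite !mxE rmorphD rmorphB rmorphM /= rmorph_nat /horner_eval.
  by rewrite hornerX hornerC mul1r subrK.
have Dj j : j != m -> (\det N)`_j = 0.
  move=> jm.
  have Ej : (\det N)`_j *+ j = (\det N)`_j *+ m.
    rewrite -[RHS]coefMn -XD coefXM; case: j {jm} => [|j]; rewrite ?mulr0n //.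
    by rewrite coef_deriv.
  case: (ltngtP j m) jm => // lt _.
    apply: (@torsA _ (m - j).-1); rewrite prednK ?subn_gt0 //.
    by rewrite mulrnBr ?(ltnW lt) // Ej subrr.
  apply: (@torsA _ (j - m).-1); rewrite prednK ?subn_gt0 //.
  by rewrite mulrnBr ?(ltnW lt) // Ej subrr.
have Dm : \det N = (\det N)`_m *: 'X^m.
  apply/polyP => j; rewrite coefZ coefXn.
  by case: eqVneq => [->|/Dj]; rewrite ?mulr1 ?mulr0.
move: D1; rewrite Dm hornerZ hornerXn expr1n mulr1 => ->.
by rewrite scale1r.
Qed.

(** Every column is an eigenvector of e: for the eigenvalue 1 at the indices in
    J and for the eigenvalue 0 at the others. *)
Definition idempotent_minor (J : {set 'I_n}) : 'M[A]_n :=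
  \matrix_(i, j) (if j \in J then e i j else (1%:M - e) i j).

(** The coefficient of 'X^m in the determinant of the pencil.  The pieces of
    Spec A on which one of these minors is invertible form a cover, and the
    columns of that minor are an eigenbasis there. *)
Lemma sum_idempotent_minors :
  \sum_(J : {set 'I_n} | #|J| == m) \det (idempotent_minor J) = 1.
Proof.
(* Each column of N is the sum of a column of 1 - e and 'X times one of e. *)
have ND : \det N =
    \sum_(J : {set 'I_n}) (\det (idempotent_minor J))%:P * 'X^#|J|.
  rewrite -det_tr /determinant.
  under eq_bigr => s _.
    under eq_bigr => i _.
      rewrite (_ : N^T i (s i) = 'X * (e (s i) i)%:P + ((1%:M - e) (s i) i)%:P);
        last by rewrite !mxE polyCB polyCMn addrC.
      over.
    rewrite bigA_distr /= mulr_sumr.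
    over.
  rewrite exchange_big /=; apply: eq_bigr => J _.
  rewrite -[X in _ = X%:P * _]det_tr /determinant rmorph_sum mulr_suml /=.
  apply: eq_bigr => s _.
  rewrite rmorphM rmorphXn rmorphN1 -mulrA; congr (_ * _).
  rewrite rmorph_prod -prodr_const (big_mkcond (mem J)) -big_split /=.
  apply: eq_bigr => i _; rewrite !mxE; case: ifP => iJ; last by rewrite mulr1.
  by rewrite mulrC.
have := congr1 (fun p : {poly A} => p`_m) ND.
rewrite det_idempotent_pencil coefXn eqxx coef_sum => E1.
rewrite -[RHS]/(true%:R) E1 big_mkcond /=; apply: eq_bigr => J _.
by rewrite coefCM coefXn eq_sym; case: eqP; rewrite ?mulr1 ?mulr0.
Qed.

End IdempotentPencil.

(** * Points of the orbit of diag(mu, ..., mu, -mu, ..., -mu) *)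

(** Used to sort an eigenbasis, so that the eigenvectors with indices in J come
    last. *)
Lemma perm_onto_set (m : nat) (J : {set 'I_(m + m)}) :
  #|J| = m -> exists s : 'S_(m + m), forall j, (s j \in J) = (m <= j)%N.
Proof.
move=> cJ; pose L := enum (~: J) ++ enum J.
have cJC : #|~: J| = m by rewrite cardsCs finset.setCK card_ord cJ addnK.
have szL : size L = (m + m)%N by rewrite size_cat -!cardE cJ cJC.
have uL : uniq L.
  rewrite cat_uniq !enum_uniq andbT /=; apply/hasPn => x.
  by rewrite !mem_enum inE negbK.
have sI : injective (fun j : 'I_(m + m) => nth j L j).
  move=> i j /=; rewrite (set_nth_default j) ?szL //.
  by move/eqP; rewrite nth_uniq ?szL // => /eqP/val_inj.
exists (perm sI) => j; rewrite permE nth_cat -cardE cJC; case: ltnP => jm.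
  have : nth j (enum (~: J)) j \in enum (~: J) by rewrite mem_nth // -cardE cJC.
  by rewrite mem_enum inE => /negPf.
by rewrite -mem_enum mem_nth // -cardE cJ ltn_subLR.
Qed.

Section Orbit.

Variables (k : fieldType) (m : nat) (mu : k) (A : comAlgType k).
Hypotheses (k0 : [pchar k] =i pred0) (mu0 : mu != 0).

Lemma alg_torsion_free : natr_torsion_free A.
Proof.
move=> y j /eqP; rewrite -scaler_nat scaler_eq0.
by rewrite (proj1 (pcharf0P k) k0) /= => /eqP.
Qed.

Lemma diag_pmE :
  diag_pm A m mu = diag_mx (\row_j (if (j < m)%N then mu%:A else - mu%:A)).
Proof.
apply/matrixP => i j; rewrite !mxE.
case: splitP => i' Ei; rewrite !mxE; case: splitP => j' Ej; rewrite !mxE.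
- by rewrite -!val_eqE /= Ei Ej.
- rewrite -val_eqE /= Ei Ej.
  by rewrite [_ == _]ltn_eqF ?ltn_addr.
- rewrite -val_eqE /= Ei Ej.
  by rewrite [_ == _]gtn_eqF ?ltn_addr.
- by rewrite -!val_eqE /= Ei Ej eqn_add2l.
Qed.

Lemma diag_pm_sqr : diag_pm A m mu *m diag_pm A m mu = ((mu ^+ 2)%:A)%:M.
Proof.
rewrite diag_pmE mulmx_diag; apply/matrixP => i j; rewrite !mxE; congr (_ *+ _).
by case: ifP; rewrite ?mulrNN -scalerAl mul1r scalerA -expr2.
Qed.

Lemma diag_pm_tr : \tr (diag_pm A m mu) = 0.
Proof. by rewrite mxtrace_block !mxtrace_scalar mulNrn subrr. Qed.

(** Both identities hold on each piece of the cover, where M is conjugate to the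
    diagonal matrix. *)
Lemma orbit_points_sqr_tr (M : 'M[A]_(m + m)) :
  orbit_points mu M -> M *m M = ((mu ^+ 2)%:A)%:M /\ \tr M = 0.
Proof.
move=> [r [f [P [Q [cf PQ]]]]]; split.
  apply/eqP; rewrite -subr_eq0; apply/eqP.
  apply: (@comaximal_submodule A _ [set X | X = 0] r f) => //=.
  - by move=> u w -> ->; rewrite addr0.
  - by move=> a u ->; rewrite scaler0.
  move=> i; exists 1; have [PQi MP] := PQ i.
  rewrite expr1 -mul_mx_scalar -PQi mulmxA mulmxBl -mulmxA MP mulmxA MP.
  by rewrite -mulmxA diag_pm_sqr scalar_mxC subrr mul0mx.
apply: (@comaximal_submodule A A^o [set x | x = 0] r f) => //=.
- by move=> u w -> ->; rewrite addr0.
- by move=> a u ->; rewrite scaler0.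
move=> i; exists (m + m).+1; have [PQi MP] := PQ i.
(* Q i inverts P i on the right up to f i.  Over a ring with zero divisors it
   does so on the left only after multiplication by the determinant of P i. *)
have QP : \det (P i) *: (Q i *m P i) = (\det (P i) * f i)%:M.
  rewrite -mul_scalar_mx -mul_adj_mx -mulmxA (mulmxA (P i)) PQi.
  by rewrite mul_scalar_mx -scalemxAr mul_adj_mx scale_scalar_mx mulrC.
have ft : f i * \tr M = \tr (diag_pm A m mu *m (Q i *m P i)).
  rewrite -mxtraceZ -mul_mx_scalar -PQi [M *m _]mulmxA MP -mulmxA.
  by rewrite mxtrace_mulC mulmxA.
have dft : \det (P i) * (f i * \tr M) = 0.
  rewrite ft -mxtraceZ scalemxAr QP mul_mx_scalar mxtraceZ diag_pm_tr.
  by rewrite mulr0.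
have := congr1 (fun X => \det X) PQi; rewrite /= det_mulmx det_scalar => fE.
rewrite exprSr -fE -[_ *: _]/(_ * _).
rewrite (_ : _ * _ = \det (Q i) * (\det (P i) * (f i * \tr M))); last by ring.
by rewrite dft mulr0.
Qed.

(** The matrix (mu - M) / (2 mu) is the projection onto the eigenspace of -mu,
    and its trace is m because that of M is 0.  Its minors of size m
    give the pieces of the cover and their columns the eigenbases. *)
Lemma sqr_tr_orbit_points (M : 'M[A]_(m + m)) :
  M *m M = ((mu ^+ 2)%:A)%:M -> \tr M = 0 -> orbit_points mu M.
Proof.
move=> MM trM; pose u : A := mu%:A; pose v : A := ((2 * mu)^-1)%:A.
have two0 : 2 != 0 :> k by rewrite (proj1 (pcharf0P k) k0).
have uv : 2 * (v * u) = 1.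
  rewrite /u /v -scalerAl mul1r scalerA invfM -mulrA mulVf // mulr1.
  by rewrite -scalerAr mulr1 -scaler_nat scalerA mulVf // scale1r.
have {}MM : M *m M = (u ^+ 2)%:M by rewrite MM exprZn expr1n.
pose e := v *: (u%:M - M).
have Me : M *m e = - u *: e.
  rewrite /e -scalemxAr scalerA [- u * v]mulrC -scalerA; congr (_ *: _).
  rewrite mulmxBr MM mul_mx_scalar scalerBr scale_scalar_mx scaleNr opprK.
  by rewrite addrC mulNr expr2 raddfN.
have ee : e *m e = e.
  rewrite {1}/e -scalemxAl mulmxBl Me mul_scalar_mx scaleNr opprK -scalerDl.
  by rewrite scalerA -mulr2n -(mulr_natl u) mulrCA uv scale1r.
have tre : \tr e = m%:R.
  rewrite mxtraceZ raddfB /= trM subr0 mxtrace_scalar mulrnAr mulrnDr.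
  by rewrite -mulrnDl -mulr2n -(mulr_natl (v * u)) uv.
have Mf : M *m (1%:M - e) = u *: (1%:M - e).
  rewrite mulmxBr Me mulmx1 scaleNr opprK scalerBr scalemx1.
  apply/eqP; rewrite eq_sym subr_eq -addrA -scalerDl -mulr2n -mulr_natl.
  by rewrite scalerA -mulrA [u * v]mulrC uv scale1r addrC subrK.
(* Subsets of another size than m are given the empty piece f = 0. *)
pose g (J : {set 'I_(m + m)}) :=
  if #|J| == m then \det (idempotent_minor e J) else 0.
have PQ J : exists PQ : 'M[A]_(m + m) * 'M[A]_(m + m),
    PQ.1 *m PQ.2 = (g J)%:M /\ M *m PQ.1 = PQ.1 *m diag_pm A m mu.
  rewrite /g; case: eqP => [cJ|_]; last first.
    by exists (0, 0); rewrite /= mul0mx mulmx0 mul0mx raddf0.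
  have [s sJ] := perm_onto_set cJ.
  pose X := idempotent_minor e J.
  exists (col_perm s X, row_perm s (\adj X)); split=> /=.
    rewrite col_permE row_permE mulmxA -(mulmxA X) -perm_mxM mulVg perm_mx1.
    by rewrite mulmx1 mul_mx_adj.
  rewrite diag_pmE mul_mx_diag; apply/matrixP => i j.
  transitivity ((M *m X) i (s j)).
    by rewrite !mxE; apply: eq_bigr => l _; rewrite !mxE.
  rewrite [RHS]mxE [X in _ * X]mxE [X in X * _]mxE ltnNge -sJ.
  case: ifPn => sjJ.
    transitivity ((M *m (1%:M - e)) i (s j)).
      rewrite [LHS]mxE [RHS]mxE.
      by apply: eq_bigr => l _; rewrite [X l _]mxE (negPf sjJ).
    by rewrite Mf mxE [X _ _]mxE (negPf sjJ) mulrC.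
  transitivity ((M *m e) i (s j)).
    rewrite [LHS]mxE [RHS]mxE.
    by apply: eq_bigr => l _; rewrite [X l _]mxE (negbNE sjJ).
  by rewrite Me mxE [X _ _]mxE (negbNE sjJ) mulrC.
have [F HF] := choice PQ.
exists #|{set 'I_(m + m)}|, (fun i => g (enum_val i)).
exists (fun i => (F (enum_val i)).1), (fun i => (F (enum_val i)).2).
split; last by move=> i; apply: HF.
exists (fun=> 1).
rewrite -[RHS](sum_idempotent_minors alg_torsion_free ee tre).
rewrite [RHS]big_mkcond /=.
rewrite [RHS](reindex _ (onW_bij _ (@enum_val_bij {set 'I_(m + m)}))) /=.
by apply: eq_bigr => i _; rewrite mul1r.
Qed.

End Orbit.

(** * Base change of a locally free quotient *)

Section Ideals.

Variables (S : comNzRingType) (I : set S).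
Hypothesis II : is_ideal I.

Lemma idealN p : I p -> I (- p).
Proof. by move=> Ip; rewrite -mulN1r; case: II => _ _; apply. Qed.

Lemma idealB p q : I p -> I q -> I (p - q).
Proof. by move=> Ip /idealN; case: II => _ + _; apply. Qed.

Lemma ideal_trans q p r : I (p - q) -> I (q - r) -> I (p - r).
Proof. by rewrite -[p - r](subrKA q); case: II => _ + _; apply. Qed.

Lemma ideal_sub_mem p q : I (p - q) -> I q -> I p.
Proof. by rewrite -{2}[p](subrK q); case: II => _ + _; apply. Qed.

End Ideals.

Lemma is_idealZ (n : nat) (A : comNzRingType) (I : set {mpoly A[n]}) a p :
  is_ideal I -> I p -> I (a *: p).
Proof. by case=> _ _ IM Ip; rewrite -mul_mpolyC; apply: IM. Qed.

Section LinearExtension.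

Variables (n : nat) (K : comNzRingType) (g : 'X_{1..n} -> K).

(** The linear form on polynomials with prescribed values g on monomials. *)
Definition linear_extension (p : {mpoly K[n]}) : K :=
  \sum_(u <- msupp p) p@_u * g u.

Lemma linear_extensionE p d : (msize p <= d)%N ->
  linear_extension p = \sum_(u : 'X_{1..n < d}) p@_u * g u.
Proof.
move=> pd; set B : subFinType _ := 'X_{1..n < d}.
rewrite /linear_extension (big_mksub B) ?msupp_uniq //=; first last.
  by move=> x /msize_mdeg_lt /leq_trans; apply.
by rewrite big_rmcond //= => j /memN_msupp_eq0 ->; rewrite mul0r.
Qed.

Lemma linear_extension_linear : linear_for *%R linear_extension.
Proof.
move=> a p q.
pose d := maxn (msize p) (maxn (msize q) (msize (a *: p + q))).
rewrite !(@linear_extensionE _ d) ?leq_max ?leqnn ?orbT //.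
rewrite mulr_sumr -big_split; apply: eq_bigr => u _.
by rewrite mcoeffD mcoeffZ mulrDl mulrA.
Qed.

HB.instance Definition _ := GRing.isLinear.Build K {mpoly K[n]} K *%R
  linear_extension linear_extension_linear.

Lemma linear_extensionX u : linear_extension 'X_[u] = g u.
Proof. by rewrite /linear_extension msuppX big_seq1 mcoeffX eqxx mul1r. Qed.

End LinearExtension.

Section BaseChangeIndependent.

Variables (n m : nat) (A : comNzRingType) (K : fieldType).
Variables (s : {rmorphism A -> K}) (I : set {mpoly A[n]}) (f : A).
Variable e : 'I_m -> {mpoly A[n]}.
Hypotheses (II : is_ideal I) (sf : s f != 0).
Hypothesis span_e : forall p, exists (N : nat) (c : 'I_m -> A),
  I (f ^+ N *: p - \sum_j c j *: e j).
Hypothesis free_e : forall c : 'I_m -> A, I (\sum_j c j *: e j) ->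
  exists N : nat, forall j, f ^+ N * c j = 0.

(** Coordinates in the basis e, after division by the power of f that clears
    denominators and application of s, form linear forms over K.  Freeness of
    e makes their value at the image of q depend only on q modulo I. *)
Lemma base_change_coordinates :
  exists lam : 'I_m -> {linear {mpoly K[n]} -> K | *%R},
  forall q c, I (q - \sum_j c j *: e j) ->
    forall l, lam l (map_mpoly s q) = s (c l).
Proof.
have /choice[d Hd] : forall u : 'X_{1..n}, exists Nc : nat * ('I_m -> A),
    I (f ^+ Nc.1 *: 'X_[u] - \sum_j Nc.2 j *: e j).
  by move=> u; have [N [c Hc]] := span_e 'X_[u]; exists (N, c).
pose g l u := (s f ^+ (d u).1)^-1 * s ((d u).2 l).
exists (fun l => linear_extension (g l)) => q c Iq l.
(* An exponent of f that serves all the monomials of q. *)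
pose N := (\sum_(u <- msupp q) (d u).1)%N.
have leN u : u \in msupp q -> ((d u).1 <= N)%N.
  by move=> uq; rewrite /N (big_rem u) //= leq_addr.
pose b l := \sum_(u <- msupp q) q@_u * f ^+ (N - (d u).1) * (d u).2 l.
have Ib : I (f ^+ N *: q - \sum_j b j *: e j).
  rewrite {1}[q]mpolyE scaler_sumr /b.
  under [X in _ - X]eq_bigr => j _ do rewrite scaler_suml.
  rewrite exchange_big -sumrB big_seq.
  apply: big_ind => [||u uq]; [by case: II | by case: II | ].
  under [X in _ - X]eq_bigr => j _ do rewrite -scalerA.
  rewrite -scaler_sumr scalerA [f ^+ N * _]mulrC.
  have -> : q@_u * f ^+ N = q@_u * f ^+ (N - (d u).1) * f ^+ (d u).1.
    by rewrite -mulrA -exprD subnK ?leN.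
  by rewrite -(scalerA _ _ 'X_[u]) -scalerBr; apply: is_idealZ.
have [N' HN'] : exists N' : nat, forall j, f ^+ N' * (f ^+ N * c j - b j) = 0.
  apply: free_e.
  under eq_bigr => j _ do rewrite scalerBl -scalerA.
  rewrite sumrB -scaler_sumr.
  have := idealB II Ib (is_idealZ (f ^+ N) II Iq).
  by rewrite scalerBr opprB addrC addrA subrK.
have /eqP := congr1 s (HN' l).
rewrite rmorph0 rmorphM rmorphXn mulf_eq0 expf_eq0 (negPf sf) andbF /=.
rewrite rmorphB rmorphM rmorphXn subr_eq0 => /eqP sb.
apply: (mulfI (expf_neq0 N sf)); rewrite sb.
rewrite {1}[q]mpolyE (raddf_sum (map_mpoly s)) linear_sum rmorph_sum mulr_sumr.
rewrite big_seq [RHS]big_seq; apply: eq_bigr => u uq /=.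
rewrite map_mpolyZ map_mpolyX linearZ /= linear_extensionX /g.
rewrite !rmorphM rmorphXn mulrCA -mulrA; congr (_ * _).
by rewrite -{1}(subnK (leN u uq)) exprD -mulrA mulVKf ?expf_neq0.
Qed.

(** The coordinate forms vanish on the base-changed ideal and are dual to the
    images of the basis. *)
Lemma base_change_independent (c : 'I_m -> K) :
  base_change s I (\sum_j c j *: map_mpoly s (e j)) -> forall l, c l = 0.
Proof.
have [lam lamE] := base_change_coordinates.
have lam0 p : base_change s I p -> forall l, lam l p = 0.
  move=> Jp l; rewrite -[p]mul1r.
  (* The kernel of a linear form contains a largest ideal. *)
  apply: (Jp [set p | forall r, lam l (r * p) = 0]).
  split.
    split=> [r|x y Hx Hy r|x y Hy r]; rewrite ?mulr0 ?linear0 //.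
      by rewrite mulrDr linearD /= Hx Hy addr0.
    by rewrite mulrA Hy.
  move=> _ [q Iq <-] r.
  rewrite [r]mpolyE mulr_suml linear_sum /= big1 // => u _.
  rewrite -scalerAl linearZ /= -(map_mpolyX s) -rmorphM /=.
  rewrite (lamE _ (fun=> 0)) ?rmorph0 ?mulr0 //.
  rewrite big1 => [|j _]; last by rewrite scale0r.
  by rewrite subr0; case: II => _ _; apply.
move=> /lam0 + l => /(_ l).
rewrite linear_sum /= (bigD1 l) //= big1 ?addr0 => [|j jl].
  rewrite linearZ /= (lamE _ (fun j => (j == l)%:R)) ?eqxx ?rmorph1 ?mulr1 //.
  rewrite (bigD1 l) //= eqxx scale1r big1 ?addr0 ?subrr; first by case: II.
  by move=> j /negPf ->; rewrite scale0r.
rewrite linearZ /= (lamE _ (fun i => (i == j)%:R)) 1?eq_sym ?(negPf jl).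
  by rewrite rmorph0 mulr0.
rewrite (bigD1 j) //= eqxx scale1r big1 ?addr0 ?subrr; first by case: II.
by move=> i /negPf ->; rewrite scale0r.
Qed.

End BaseChangeIndependent.

(** * Transverse families have a basis of powers *)

Section PolyAt.

Variables (n : nat) (A : comNzRingType) (x : {mpoly A[n]}).

(** The comorphism of the map x from the affine space to the line. *)
Definition poly_at : {poly A} -> {mpoly A[n]} :=
  horner_eval x \o map_poly (@mpolyC n A).

HB.instance Definition _ := GRing.RMorphism.on poly_at.

Lemma poly_atE q : poly_at q = (map_poly (@mpolyC n A) q).[x].
Proof. by []. Qed.

Lemma poly_atC c : poly_at c%:P = c%:MP.
Proof. by rewrite poly_atE map_polyC hornerC. Qed.

Lemma poly_atX : poly_at 'X = x.
Proof. by rewrite poly_atE map_polyX hornerX. Qed.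

Lemma poly_atZ c q : poly_at (c *: q) = c *: poly_at q.
Proof. by rewrite -mul_polyC rmorphM /= poly_atC mul_mpolyC. Qed.

Lemma poly_at_sum m (q : {poly A}) : (size q <= m)%N ->
  poly_at q = \sum_(i < m) q`_i *: x ^+ i.
Proof.
move=> qm; rewrite poly_atE (@horner_coef_wide _ m).
  by apply: eq_bigr => i _; rewrite coef_map mul_mpolyC.
exact: leq_trans (size_poly _ _) qm.
Qed.

End PolyAt.

Lemma map_poly_at (n : nat) (A B : comNzRingType) (s : {rmorphism A -> B})
    (x : {mpoly A[n]}) q :
  map_mpoly s (poly_at x q) = poly_at (map_mpoly s x) (map_poly s q).
Proof.
rewrite (poly_at_sum x (leqnn (size q))) raddf_sum /=.
rewrite (@poly_at_sum _ _ _ (size q)) ?size_poly //.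
by apply: eq_bigr => i _; rewrite map_mpolyZ rmorphXn coef_map.
Qed.

Lemma map_mpoly_ideal (n : nat) (A B : comNzRingType) (f : A -> B)
    (I : set {mpoly A[n]}) p :
  I p -> base_change f I (map_mpoly f p).
Proof. by move=> Ip J [_ IJ]; apply: IJ; exists p. Qed.

(** Otherwise the quotient would be spanned by the images of the powers of x
    below the degree of v, that is, by fewer than m elements. *)
Lemma transverse_powers_independent (n m : nat) (K : fieldType)
    (J : set {mpoly K[n]}) (x : {mpoly K[n]}) (e : 'I_m -> {mpoly K[n]})
    (v : {poly K}) :
  is_ideal J -> transverse x J ->
  (forall c : 'I_m -> K, J (\sum_j c j *: e j) -> forall j, c j = 0) ->
  (size v <= m)%N -> J (poly_at x v) -> v = 0.
Proof.
move=> JI T free_e sv Jv; apply/eqP; apply: contraT => v0.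
have [q qE] := choice (fun l => T (e l)).
have JM r : J (poly_at x (r * v)) by rewrite rmorphM; case: JI => _ _; apply.
pose d := (size v).-1.
have dE : d.+1 = size v by rewrite prednK // size_poly_gt0.
pose r l := q l %% v.
have szr l : (size (r l) <= d)%N by rewrite -ltnS dE ltn_modp.
have rE l : J (e l - poly_at x (r l)).
  apply: (ideal_trans JI (qE l)); rewrite -poly_atE -rmorphB.
  by rewrite {1}(divp_eq (q l) v) addrK; apply: JM.
(* The coordinates of m elements on d < m powers are linearly dependent. *)
pose C : 'M[K]_(m, d) := \matrix_(l, j) (r l)`_j.
have : kermx C != 0.
  rewrite -mxrank_eq0 mxrank_ker subn_eq0 -ltnNge.
  by rewrite (leq_ltn_trans (rank_leq_col C)) // dE.
case/rowV0Pn => u /sub_kermxP uC /negP[]; apply/eqP.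
apply/rowP => l; rewrite mxE.
apply: (free_e (fun j => u 0 j)).
have -> : \sum_j u 0 j *: e j = \sum_j u 0 j *: (e j - poly_at x (r j)).
  under [RHS]eq_bigr => j _ do rewrite scalerBr.
  rewrite sumrB [X in _ - X](_ : _ = 0) ?subr0 //.
  under eq_bigr => j _ do rewrite -poly_atZ.
  rewrite -rmorph_sum (_ : \sum_j _ = 0) ?rmorph0 //.
  apply/polyP => i; rewrite coef0 coef_sum.
  under eq_bigr => j _ do rewrite coefZ.
  case: (ltnP i d) => id.
    have := congr1 (fun M : 'rV_d => M 0 (Ordinal id)) uC; rewrite !mxE.
    by apply: etrans; apply: eq_bigr => j _; rewrite mxE.
  by rewrite big1 // => j _; rewrite nth_default ?mulr0 // (leq_trans (szr j)).
by apply: is_ideal_sum => // j; apply: is_idealZ.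
Qed.

Section TransverseBasis.

Variables (n m : nat) (A : comNzRingType).
Variables (I : set {mpoly A[n]}) (x : {mpoly A[n]}).
Hypotheses (II : is_ideal I) (LF : locally_free_quotient m I).
Hypothesis TI : forall (K : fieldType) (s : {rmorphism A -> K}),
  transverse (map_mpoly s x) (base_change s I).

(** Let d_i be the determinant of the powers of x in the local basis over the
    i-th piece.  At a field-valued point where f_i is nonzero, d_i is nonzero as
    well, since the powers are independent there.  Hence the f_i d_i have no
    common zero, and over the i-th piece of this finer cover Cramer's rule
    turns the local basis into the powers of x. *)
Lemma transverse_local_basis : exists (r : nat) (g : 'I_r -> A),
  comaximal g /\
  forall i,
    (forall p, exists (N : nat) (c : {poly A}),
       (size c <= m)%N /\ I (g i ^+ N *: p - poly_at x c)) /\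
    (forall c : {poly A}, (size c <= m)%N -> I (poly_at x c) ->
       exists N : nat, g i ^+ N *: c = 0).
Proof.
have [r [f [e [cf H]]]] := LF.
have /choice[C HC] : forall i, exists C : nat * 'M[A]_m, forall j : 'I_m,
    I (f i ^+ C.1 *: x ^+ j - \sum_l C.2 j l *: e i l).
  move=> i; have [sp _] := H i.
  have /choice[c Hc] : forall j : 'I_m, exists Nc : nat * ('I_m -> A),
      I (f i ^+ Nc.1 *: x ^+ j - \sum_l Nc.2 l *: e i l).
    by move=> j; have [N [c Hc]] := sp (x ^+ j); exists (N, c).
  pose N := (\sum_j (c j).1)%N.
  exists (N, \matrix_(j, l) (f i ^+ (N - (c j).1) * (c j).2 l)) => j /=.
  have leN : ((c j).1 <= N)%N by rewrite /N (bigD1 j) //= leq_addr.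
  under eq_bigr => l _ do rewrite mxE -scalerA.
  rewrite -scaler_sumr -{1}(subnK leN) exprD -(scalerA _ _ (x ^+ j)) -scalerBr.
  exact: is_idealZ.
pose d i := \det (C i).2.
exists r, (fun i => f i * d i); split.
  pose G : set A :=
    [set a | exists h : 'I_r -> A, a = \sum_i h i * (f i * d i)].
  have GI : is_ideal G.
    split.
    - by exists (fun=> 0); rewrite big1 // => i _; rewrite mul0r.
    - move=> _ _ [h ->] [h' ->]; exists (fun i => h i + h' i).
      by rewrite -big_split; apply: eq_bigr => i _; rewrite mulrDl.
    - move=> p _ [h ->]; exists (fun i => p * h i).
      by rewrite mulr_sumr; apply: eq_bigr => i _; rewrite mulrA.
  suff [h hE] : G 1 by exists h; rewrite -hE.
  apply: contrapT => /(proper_ideal_field_point GI)[K [s sG]].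
  have [i sfi] : exists i, s (f i) != 0.
    apply: (@comaximal_field K r (fun i => s (f i))).
    have [h hf] := cf; exists (fun i => s (h i)).
    rewrite -(rmorph1 s) -hf rmorph_sum.
    by apply: eq_bigr => j _; rewrite rmorphM.
  have sd0 : s (d i) = 0.
    have Gi : G (f i * d i).
      exists (fun j => (j == i)%:R).
      rewrite (bigD1 i) //= eqxx mul1r big1 ?addr0 // => j /negPf ->.
      by rewrite mul0r.
    by have /eqP := sG _ Gi; rewrite rmorphM mulf_eq0 (negPf sfi) => /eqP.
  have [sp fr] := H i.
  have free_e := base_change_independent II sfi sp fr.
  have /eqP : \det (map_mx s (C i).2) = 0 by rewrite det_map_mx.
  case/det0P => v v0 vC; case/eqP: v0.
  have JI : is_ideal (base_change s I) by apply: base_change_ideal.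
  have v0 : rVpoly v = 0.
    apply: (transverse_powers_independent JI (@TI K s) free_e).
      exact: size_poly.
    rewrite (poly_at_sum _ (size_poly _ _)).
    pose N := (C i).1.
    have -> : \sum_(j < m) (rVpoly v)`_j *: map_mpoly s x ^+ j =
       s (f i) ^- N *: \sum_(j < m) v 0 j *: map_mpoly s
          (f i ^+ N *: x ^+ j - \sum_l (C i).2 j l *: e i l).
      have mapE j : map_mpoly s (f i ^+ N *: x ^+ j) =
          s (f i) ^+ N *: map_mpoly s x ^+ j.
        by rewrite map_mpolyZ !rmorphXn.
      under [X in _ = _ *: X]eq_bigr => j _.
        rewrite rmorphB /= mapE (raddf_sum (map_mpoly s)) /= scalerBr scalerA.
        rewrite mulrC -scalerA scaler_sumr.
        under [X in _ - X]eq_bigr => l _ do rewrite map_mpolyZ scalerA.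
        over.
      rewrite sumrB [X in _ - X]exchange_big /= [X in _ - X]big1 => [|l _].
        rewrite subr0 -scaler_sumr scalerA mulVf ?expf_neq0 // scale1r.
        by apply: eq_bigr => j _; rewrite coef_rVpoly_ord.
      rewrite -scaler_suml (_ : \sum_j _ = (v *m map_mx s (C i).2) 0 l).
        by rewrite vC mxE scale0r.
      by rewrite mxE; apply: eq_bigr => j _; rewrite mxE.
    apply: (is_idealZ _ JI); apply: (is_ideal_sum _ JI) => j.
    by apply: (is_idealZ _ JI); apply: map_mpoly_ideal; apply: HC.
  by apply/rowP => j; rewrite -coef_rVpoly_ord v0 coef0 mxE.
move=> i; have [sp fr] := H i; pose N' := (C i).1; pose M := (C i).2.
have powers (v : 'rV[A]_m) :
    I (f i ^+ N' *: poly_at x (rVpoly v) - \sum_l (v *m M) 0 l *: e i l).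
  rewrite (poly_at_sum _ (size_poly _ _)) scaler_sumr.
  under [X in _ - X]eq_bigr => l _ do rewrite mxE scaler_suml.
  rewrite exchange_big -sumrB /=; apply: is_ideal_sum => // j.
  rewrite coef_rVpoly_ord scalerA [_ * v _ _]mulrC -scalerA.
  under [X in _ - X]eq_bigr => l _ do rewrite -scalerA.
  by rewrite -scaler_sumr -scalerBr; apply: is_idealZ => //; apply: HC.
split.
  move=> p; have [N [c Hc]] := sp p.
  pose v : 'rV[A]_m := (\row_l c l) *m \adj M.
  (* The extra factor f i * d i ^+ N completes f i ^+ N * d i to a power of
     f i * d i. *)
  exists N.+1, ((f i * d i ^+ N * f i ^+ N') *: rVpoly v); split.
    by rewrite (leq_trans (size_scale_leq _ _)) ?size_poly.
  have /(is_idealZ (f i * d i ^+ N) II) := powers v.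
  rewrite -mulmxA mul_adj_mx mul_mx_scalar => Hv.
  have := idealB II (is_idealZ (f i * d i ^+ N.+1) II Hc) Hv.
  have -> : \sum_l (d i *: \row_l0 c l0) 0 l *: e i l =
      d i *: \sum_l c l *: e i l.
    by rewrite scaler_sumr; apply: eq_bigr => l _; rewrite !mxE scalerA.
  rewrite poly_atZ !scalerBr !scalerA opprB.
  have -> : f i * d i ^+ N.+1 * f i ^+ N = (f i * d i) ^+ N.+1.
    by rewrite exprMn [f i ^+ N.+1]exprS mulrAC.
  by rewrite -[_ * d i ^+ N * d i]mulrA -exprSr addrA subrK.
move=> c cm Ic; pose v : 'rV[A]_m := poly_rV c.
have cE : c = rVpoly v by rewrite poly_rV_K.
have [N HN] : exists N, forall l, f i ^+ N * (v *m M) 0 l = 0.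
  apply: fr; apply: (ideal_sub_mem II (q := f i ^+ N' *: poly_at x (rVpoly v))).
    by rewrite -opprB; apply: idealN.
  by apply: is_idealZ => //; rewrite -cE.
exists N.+1.
have Hv : (f i ^+ N * d i) *: v = 0.
  rewrite -scalerA -[d i *: v]mul_mx_scalar -mul_mx_adj mulmxA scalemxAl.
  rewrite (_ : _ *: _ = 0) ?mul0mx //.
  by apply/rowP => l; rewrite mxE HN mxE.
have -> : (f i * d i) ^+ N.+1 = f i * d i ^+ N * (f i ^+ N * d i).
  by rewrite exprMn exprS exprSr; ring.
rewrite cE -scalerA (_ : (f i ^+ N * d i) *: rVpoly v = 0) ?scaler0 //.
by rewrite -linearZ /= Hv linear0.
Qed.

(** On an affine base the local bases of powers glue, as the powers of x are
    globally defined. *)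
Lemma transverse_power_basis :
  (forall p, exists c : {poly A}, (size c <= m)%N /\ I (p - poly_at x c)) /\
  (forall c : {poly A}, (size c <= m)%N -> I (poly_at x c) -> c = 0).
Proof.
have [r [g [cg H]]] := transverse_local_basis; split.
  move=> p.
  apply: (@comaximal_submodule A _ [set p | exists c : {poly A},
    (size c <= m)%N /\ I (p - poly_at x c)] r g) => //=.
  - by exists 0; rewrite size_poly0 rmorph0 subr0; split=> //; case: II.
  - move=> u w [c [sc Ic]] [c' [sc' Ic']]; exists (c + c'); split.
      by rewrite (leq_trans (size_polyD _ _)) // geq_max sc.
    by rewrite rmorphD opprD addrACA; case: II => _ + _; apply.
  - move=> a u [c [sc Ic]]; exists (a *: c); split.
      by rewrite (leq_trans (size_scale_leq _ _)).
    by rewrite poly_atZ -scalerBr; apply: is_idealZ.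
  move=> i; have [sp _] := H i; have [N [c [sc Ic]]] := sp p.
  by exists N, c.
move=> c sc Ic.
apply: (@comaximal_submodule A _ [set c | c = 0] r g) => //=.
- by move=> u w -> ->; rewrite addr0.
- by move=> a u ->; rewrite scaler0.
by move=> i; have [_ fr] := H i; apply: fr.
Qed.

End TransverseBasis.

(** * Graphs over the zero scheme of a monic polynomial *)

Lemma rmodp_map (A B : comNzRingType) (f : {rmorphism A -> B})
    (Q p : {poly A}) :
  Q \is monic ->
  rmodp (map_poly f p) (map_poly f Q) = map_poly f (rmodp p Q).
Proof.
move=> mQ; have mfQ : map_poly f Q \is monic by apply: monic_map.
rewrite {1}(rdivp_eq mQ p) rmorphD rmorphM rmodp_addl_mul_small //.
rewrite [size (map_poly f Q)]size_map_poly_id0; first last.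
  by rewrite (monicP mQ) rmorph1 oner_eq0.
by rewrite (leq_ltn_trans (size_poly _ _)) // ltn_rmodp monic_neq0.
Qed.

Definition ord_a : 'I_3 := @Ordinal 3 0 isT.
Definition ord_c : 'I_3 := @Ordinal 3 1 isT.
Definition ord_x : 'I_3 := @Ordinal 3 2 isT.

Section GraphIdeal.

Variable A : comNzRingType.
Implicit Types (Q al ga : {poly A}) (p : {mpoly A[3]}).

(** Restriction of functions to the curve x |-> (al x, ga x, x). *)
Definition graph_eval al ga : {mpoly A[3]} -> {poly A} :=
  mmap (@polyC A) (fun i : 'I_3 => [:: al; ga; 'X]`_i).

HB.instance Definition _ al ga := GRing.RMorphism.on (graph_eval al ga).

Lemma graph_evalZ al ga c p :
  graph_eval al ga (c *: p) = c *: graph_eval al ga p.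
Proof. by rewrite /graph_eval mmapZ mul_polyC. Qed.

Lemma graph_evalC al ga c : graph_eval al ga c%:MP = c%:P.
Proof. exact: mmapC. Qed.

Lemma graph_eval_var al ga (i : 'I_3) :
  graph_eval al ga 'X_i = [:: al; ga; 'X]`_i.
Proof. by rewrite /graph_eval mmapX mmap1U. Qed.

Lemma graph_eval_poly_at al ga q : graph_eval al ga (poly_at 'X_ord_x q) = q.
Proof.
rewrite (poly_at_sum _ (leqnn (size q))) rmorph_sum /= -[RHS]coefK poly_def.
apply: eq_bigr => i _.
by rewrite graph_evalZ rmorphXn /= graph_eval_var.
Qed.

(** The polynomials congruent to their restriction to the curve form a subring
    that contains the three coordinates. *)
Lemma graph_eval_equiv (I : set {mpoly A[3]}) al ga p :
  is_ideal I -> I ('X_ord_a - poly_at 'X_ord_x al) ->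
  I ('X_ord_c - poly_at 'X_ord_x ga) ->
  I (p - poly_at 'X_ord_x (graph_eval al ga p)).
Proof.
move=> II Ia Ic; have [I0 ID IM] := II.
pose E q := poly_at 'X_ord_x (graph_eval al ga q); rewrite -/(E p).
have EM q r : I (q - E q) -> I (r - E r) -> I (q * r - E (q * r)).
  move=> Iq Ir; rewrite /E !rmorphM /= -/(E q) -/(E r).
  have -> : q * r - E q * E r = q * (r - E r) + E r * (q - E q) by ring.
  by apply: ID; apply: IM.
have E1 : I (1 - E 1) by rewrite /E !rmorph1 subrr.
have EX i : I ('X_i - E 'X_i).
  rewrite /E graph_eval_var; case: i => [[|[|[|//]]] i3] /=.
  - by rewrite (_ : Ordinal i3 = ord_a) //; apply: val_inj.
  - by rewrite (_ : Ordinal i3 = ord_c) //; apply: val_inj.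
  - rewrite (_ : Ordinal i3 = ord_x); last exact: val_inj.
    by rewrite poly_atX subrr.
elim/mpolyind: p => [|c u p _ _ IHp]; first by rewrite /E !rmorph0 subrr.
rewrite /E !rmorphD /= -/(E p) opprD addrACA; apply: ID => //.
rewrite graph_evalZ poly_atZ -scalerBr; apply: is_idealZ => //.
rewrite -/(E _) mpolyXE_id; apply: (big_ind (fun q => I (q - E q))) => // i _.
elim: (u i) => [|d IHd]; first by rewrite expr0.
by rewrite exprS; apply: EM.
Qed.

(** The ideal of the part of the curve x |-> (al x, ga x, x) over Q = 0. *)
Definition graph_ideal Q al ga : set {mpoly A[3]} :=
  [set p | rmodp (graph_eval al ga p) Q = 0].

Section Monic.

Variables (Q al ga : {poly A}).
Hypothesis mQ : Q \is monic.

Lemma graph_ideal_ideal : is_ideal (graph_ideal Q al ga).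
Proof.
split=> [|p q /= Ip Iq|p q /= Iq]; rewrite /graph_ideal /=.
- by rewrite rmorph0 rmod0p.
- by rewrite rmorphD rmodpD //= Ip Iq addr0.
- by rewrite rmorphM -rmodp_mulmr //= Iq mulr0 rmod0p.
Qed.

Lemma graph_ideal_a : graph_ideal Q al ga ('X_ord_a - poly_at 'X_ord_x al).
Proof.
rewrite /graph_ideal /= rmorphB /= graph_eval_poly_at graph_eval_var /=.
by rewrite subrr rmod0p.
Qed.

Lemma graph_ideal_c : graph_ideal Q al ga ('X_ord_c - poly_at 'X_ord_x ga).
Proof.
rewrite /graph_ideal /= rmorphB /= graph_eval_poly_at graph_eval_var /=.
by rewrite subrr rmod0p.
Qed.

Lemma graph_ideal_poly_at q :
  graph_ideal Q al ga (poly_at 'X_ord_x q) <-> rmodp q Q = 0.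
Proof. by rewrite /graph_ideal /= graph_eval_poly_at. Qed.

Lemma graph_ideal_Q : graph_ideal Q al ga (poly_at 'X_ord_x Q).
Proof. by apply/graph_ideal_poly_at; rewrite rmodpp. Qed.

Lemma graph_ideal_min (I : set {mpoly A[3]}) :
  is_ideal I -> I ('X_ord_a - poly_at 'X_ord_x al) ->
  I ('X_ord_c - poly_at 'X_ord_x ga) -> I (poly_at 'X_ord_x Q) ->
  graph_ideal Q al ga `<=` I.
Proof.
move=> II Ia Ic IQ p Ip.
apply: (ideal_sub_mem II (graph_eval_equiv p II Ia Ic)).
rewrite (rdivp_eq mQ (graph_eval al ga p)) Ip addr0 rmorphM.
by case: II => _ _; apply.
Qed.

End Monic.

(** The remainders of 'X^m, a and c on the basis of powers of x recover the
    three polynomials. *)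
Lemma graph_ideal_inj m Q Q' al al' ga ga' :
  Q \is monic -> Q' \is monic -> size Q = m.+1 -> size Q' = m.+1 ->
  (size al <= m)%N -> (size al' <= m)%N ->
  (size ga <= m)%N -> (size ga' <= m)%N ->
  graph_ideal Q al ga = graph_ideal Q' al' ga' ->
  [/\ Q = Q', al = al' & ga = ga'].
Proof.
move=> mQ mQ' sQ sQ' sal sal' sga sga' E.
have small (u v : {poly A}) : (size u <= m)%N -> (size v <= m)%N ->
    graph_ideal Q' al' ga' (poly_at 'X_ord_x (u - v)) -> u = v.
  move=> su sv /graph_ideal_poly_at; rewrite rmodp_small.
    by move/eqP; rewrite subr_eq0 => /eqP.
  by rewrite sQ' ltnS (leq_trans (size_polyD _ _)) // geq_max size_polyN su.
have II := graph_ideal_ideal al' ga' mQ'.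
split.
- have := graph_ideal_Q al ga mQ.
  rewrite E => /graph_ideal_poly_at; rewrite -(subrK Q' Q) rmodpD //.
  rewrite rmodpp // addr0 rmodp_small.
    by move=> ->; rewrite add0r.
  rewrite sQ' ltnS; apply/leq_sizeP => j; rewrite leq_eqVlt coefB.
  case/predU1P => [<-|lj]; last by rewrite !nth_default ?sQ ?sQ' // subrr.
  have : lead_coef Q - lead_coef Q' = 0.
    by rewrite (monicP mQ) (monicP mQ') subrr.
  by rewrite !lead_coefE sQ sQ'.
- apply: small => //; rewrite rmorphB /=.
  have := graph_ideal_a Q al ga; rewrite E => Ea.
  have := idealB II (graph_ideal_a Q' al' ga') Ea.
  by congr (graph_ideal _ _ _ _); ring.
- apply: small => //; rewrite rmorphB /=.
  have := graph_ideal_c Q al ga; rewrite E => Ec.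
  have := idealB II (graph_ideal_c Q' al' ga') Ec.
  by congr (graph_ideal _ _ _ _); ring.
Qed.

End GraphIdeal.

(** Division by a monic polynomial commutes with base change. *)
Lemma base_change_graph_ideal (A B : comNzRingType) (f : {rmorphism A -> B})
    (Q al ga : {poly A}) :
  Q \is monic ->
  base_change f (graph_ideal Q al ga) =
  graph_ideal (map_poly f Q) (map_poly f al) (map_poly f ga).
Proof.
move=> mQ; have mfQ : map_poly f Q \is monic by apply: monic_map.
have EI p : graph_ideal Q al ga p -> base_change f (graph_ideal Q al ga)
    (map_mpoly f p) by apply: map_mpoly_ideal.
apply/seteqP; split.
  move=> p; apply; split; first exact: graph_ideal_ideal.
  move=> _ [q Iq <-]; rewrite /graph_ideal /=.
  have -> : graph_eval (map_poly f al) (map_poly f ga) (map_mpoly f q) =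
      map_poly f (graph_eval al ga q).
    elim/mpolyind: q {Iq} => [|c u q _ _ IHq]; first by rewrite !rmorph0.
    rewrite !rmorphD /= IHq map_mpolyZ map_mpolyX !graph_evalZ linearZ /=.
    congr (_ *: _ + _).
    rewrite /graph_eval !mmapX /mmap1 rmorph_prod; apply: eq_bigr => i _.
    rewrite rmorphXn; congr (_ ^+ _).
    by case: i => [[|[|[|]]]] //= _; rewrite map_polyX.
  by rewrite rmodp_map // Iq rmorph0.
apply: graph_ideal_min => //; first exact: base_change_ideal.
- have := EI _ (graph_ideal_a Q al ga).
  by rewrite rmorphB /= map_mpolyX map_poly_at map_mpolyX.
- have := EI _ (graph_ideal_c Q al ga).
  by rewrite rmorphB /= map_mpolyX map_poly_at map_mpolyX.
- by have := EI _ (graph_ideal_Q al ga mQ); rewrite map_poly_at map_mpolyX.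
Qed.

Section Chart.

Variables (k : fieldType) (m : nat) (A : comAlgType k) (F : {mpoly k[3]}).

Lemma map_Xx (K : nzRingType) (s : {rmorphism k -> K}) :
  map_mpoly s (Xx k) = 'X_ord_x.
Proof. by rewrite map_mpolyX. Qed.

(** Division by Q makes the powers of x a global basis, and this persists on
    every fibre. *)
Lemma graph_ideal_transverse (Q al ga : {poly A}) :
  Q \is monic -> size Q = m.+1 ->
  graph_ideal Q al ga (map_mpoly (in_alg A) F) ->
  transverse_hilbert_points F (Xx k) m (graph_ideal Q al ga).
Proof.
move=> mQ sQ IF; have II := graph_ideal_ideal al ga mQ.
split.
  split=> //; exists 1, (fun=> 1), (fun _ j => 'X_ord_x ^+ j); split.
    by exists (fun=> 1); rewrite big_ord1 mulr1.
  move=> _; split.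
    move=> p; pose q := rmodp (graph_eval al ga p) Q.
    have sq : (size q <= m)%N by rewrite -ltnS -sQ ltn_rmodp monic_neq0.
    exists 0, (fun j => q`_j); rewrite expr0 scale1r -poly_at_sum //.
    rewrite /graph_ideal /= rmorphB /= graph_eval_poly_at rmodpB // /q.
    by rewrite rmodp_id // subrr.
  move=> c Ic; exists 0 => j; rewrite expr0 mul1r.
  pose q := \poly_(i < m) nth 0 (codom c) i.
  have qE (i : 'I_m) : q`_i = c i.
    rewrite coef_poly ltn_ord (nth_map i) ?size_enum_ord //.
    by rewrite nth_ord_enum.
  rewrite -qE (_ : q = 0) ?coef0 //.
  have sq : (size q <= m)%N by apply: size_poly.
  have /graph_ideal_poly_at : graph_ideal Q al ga (poly_at 'X_ord_x q).
    by rewrite (poly_at_sum _ sq); under eq_bigr do rewrite qE.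
  by rewrite rmodp_small // sQ ltnS.
move=> K s; rewrite base_change_graph_ideal // => p.
have msQ : map_poly s Q \is monic by apply: monic_map.
exists (graph_eval (map_poly s al) (map_poly s ga) p).
rewrite map_Xx -poly_atE; apply: graph_eval_equiv.
- exact: graph_ideal_ideal.
- exact: graph_ideal_a.
- exact: graph_ideal_c.
Qed.

(** The three polynomials are the expansions of x ^ m, a and c in the basis of
    powers of x. *)
Lemma transverse_graph_ideal (I : set {mpoly A[3]}) :
  transverse_hilbert_points F (Xx k) m I ->
  exists Q al ga : {poly A}, [/\ Q \is monic, size Q = m.+1,
    (size al <= m)%N, (size ga <= m)%N & I = graph_ideal Q al ga].
Proof.
move=> [[II _ LF] TI].
have [sp fr] : (forall p, exists c : {poly A},
      (size c <= m)%N /\ I (p - poly_at 'X_ord_x c)) /\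
   (forall c : {poly A}, (size c <= m)%N -> I (poly_at 'X_ord_x c) -> c = 0).
  apply: transverse_power_basis => // K s.
  by have := TI K s; rewrite map_Xx map_mpolyX.
have [al [sal Ial]] := sp 'X_ord_a.
have [ga [sga Iga]] := sp 'X_ord_c.
have [q [sq Iq]] := sp ('X_ord_x ^+ m).
pose Q := 'X^m - q.
have sQ : size Q = m.+1.
  by rewrite size_polyDl ?size_polyXn // size_polyN ltnS.
have mQ : Q \is monic.
  by rewrite monicE lead_coefE sQ coefB coefXn eqxx nth_default ?subr0.
have IQ : I (poly_at 'X_ord_x Q).
  by rewrite rmorphB rmorphXn /= poly_atX.
exists Q, al, ga; split=> //; apply/seteqP; split; last exact: graph_ideal_min.
move=> p Ip; apply: fr; first by rewrite -ltnS -sQ ltn_rmodp monic_neq0.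
have := graph_eval_equiv p II Ial Iga.
rewrite {1}(rdivp_eq mQ (graph_eval al ga p)) rmorphD opprD addrA => H.
have IpM : I (p - poly_at 'X_ord_x (rdivp (graph_eval al ga p) Q * Q)).
  by apply: idealB => //; rewrite rmorphM; case: II => _ _; apply.
have := idealB II IpM H.
by congr (I _); ring.
Qed.

End Chart.

(** * Restriction of scalars from A[z]/Q to A *)

Lemma eq_parity (i j : nat) : (i == j) = (odd i == odd j) && (i./2 == j./2).
Proof.
apply/eqP/andP => [->|[/eqP oij /eqP hij]]; first by rewrite !eqxx.
by rewrite -(odd_double_half i) oij hij odd_double_half.
Qed.

Section Restriction.

Variables (A : comNzRingType) (m : nat) (Q : {poly A}).
Hypotheses (mQ : Q \is monic) (sQ : size Q = m.+1).
Implicit Types W : bool -> bool -> {poly A}.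

Lemma sum_odd_half (G : bool -> nat -> A) :
  \sum_(j < m + m) G (odd j) j./2 = \sum_(l < m) (G false l + G true l).
Proof.
rewrite -(big_mkord xpredT (fun j => G (odd j) j./2)).
rewrite -(big_mkord xpredT (fun l => G false l + G true l)).
elim: m => [|p IHp]; first by rewrite !big_nil.
rewrite addnS addSn !big_nat_recr //= IHp addnn /= odd_double /=.
by rewrite uphalf_double doubleK addrA.
Qed.

Lemma half_ord (i : 'I_(m + m)) : (i./2 < m)%N.
Proof. by rewrite ltn_half_double -addnn. Qed.

(** The A-linear map given by the 2 x 2 matrix W on the free A[z]/Q-module of
    rank 2, in the basis that lists z ^ l times the basis vector b at the index
    2 l + b. *)
Definition restrict_mx W : 'M[A]_(m + m) :=
  \matrix_(i, j) (rmodp (W (odd i) (odd j) * 'X^(j./2)) Q)`_(i./2).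

Definition block_mul W W' : bool -> bool -> {poly A} :=
  fun a b => W a false * W' false b + W a true * W' true b.

Definition block_diag (p : {poly A}) : bool -> bool -> {poly A} :=
  fun a b => if a == b then p else 0.

(** A[z]/Q-linearity of the multiplication by p, in terms of the basis of
    powers of z. *)
Lemma rmodp_coef_sum (p q : {poly A}) :
  rmodp (p * q) Q = \sum_(l < m) (rmodp q Q)`_l *: rmodp (p * 'X^l) Q.
Proof.
have sq : (size (rmodp q Q) <= m)%N by rewrite -ltnS -sQ ltn_rmodp monic_neq0.
rewrite -rmodp_mulmr // -{1}[rmodp q Q](take_poly_id sq) /take_poly poly_def.
rewrite mulr_sumr rmodp_sum //.
by apply: eq_bigr => l _; rewrite -scalerAr rmodpZ.
Qed.

Lemma restrict_mxM W W' :
  restrict_mx W *m restrict_mx W' = restrict_mx (block_mul W W').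
Proof.
apply/matrixP => i j; rewrite !mxE.
under eq_bigr => l _ do rewrite !mxE.
rewrite (sum_odd_half (fun a l => (rmodp (W (odd i) a * 'X^l) Q)`_(i./2) *
  (rmodp (W' a (odd j) * 'X^(j./2)) Q)`_l)).
rewrite /block_mul mulrDl -!mulrA rmodpD // coefD !rmodp_coef_sum !coef_sum.
rewrite -big_split; apply: eq_bigr => l _ /=.
by rewrite !coefZ; congr (_ + _); rewrite mulrC.
Qed.

Lemma restrict_mxD W W' :
  restrict_mx W + restrict_mx W' = restrict_mx (fun a b => W a b + W' a b).
Proof. by apply/matrixP => i j; rewrite !mxE mulrDl rmodpD // coefD. Qed.

Lemma eq_restrict_mx W W' :
  (forall a b, rmodp (W a b) Q = rmodp (W' a b) Q) ->
  restrict_mx W = restrict_mx W'.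
Proof.
move=> E; apply/matrixP => i j; rewrite !mxE ![_ * 'X^_]mulrC.
by rewrite -rmodp_mulmr // E rmodp_mulmr.
Qed.

Lemma restrict_mx_scalar (c : A) : restrict_mx (block_diag c%:P) = c%:M.
Proof.
apply/matrixP => i j; rewrite !mxE /block_diag.
rewrite -[i == j]/(i == j :> nat) eq_parity.
case: eqP => _; last by rewrite mul0r rmod0p coef0.
rewrite mul_polyC rmodp_small ?coefZ ?coefXn; first by rewrite mulr_natr.
rewrite (leq_ltn_trans (size_scale_leq _ _)) // size_polyXn sQ !ltnS.
exact: half_ord.
Qed.

Lemma restrict_mx_diag0 p : restrict_mx (block_diag p) = 0 -> rmodp p Q = 0.
Proof.
move=> E; apply/polyP => l; rewrite coef0.
have [lm|ml] := ltnP l m; last first.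
  by rewrite nth_default // (leq_trans _ ml) // -ltnS -sQ ltn_rmodp monic_neq0.
have i_lt : (l.*2 < m + m)%N by rewrite addnn ltn_double.
have j_lt : (0 < m + m)%N by apply: leq_ltn_trans i_lt.
have := congr1 (fun M : 'M[A]_(m + m) => M (Ordinal i_lt) (Ordinal j_lt)) E.
by rewrite !mxE /= odd_double doubleK /block_diag eqxx expr0 mulr1.
Qed.

Lemma restrict_mx_tr W : W true true = - W false false ->
  \tr (restrict_mx W) = 0.
Proof.
move=> W0; rewrite /mxtrace; under eq_bigr => j _ do rewrite mxE.
rewrite (sum_odd_half (fun a l => (rmodp (W a a * 'X^l) Q)`_l)) big1 // => l _.
by rewrite W0 mulNr rmodpN // coefN subrr.
Qed.

(** Multiplication by s on A[z]/Q + s A[z]/Q, where s ^ 2 = z.  Its restriction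
    of scalars is the companion matrix of Q (s ^ 2). *)
Definition block_shift : bool -> bool -> {poly A} :=
  fun a b => if a then (if b then 0 else 1) else (if b then 'X else 0).

Lemma modXn_monic : rmodp 'X^m Q = 'X^m - Q.
Proof.
rewrite -{1}(subrK Q 'X^m) rmodpD // rmodpp // addr0 rmodp_small //.
rewrite sQ ltnS; apply/leq_sizeP => j; rewrite leq_eqVlt coefB coefXn.
case/predU1P => [<-|mj]; last by rewrite gtn_eqF // nth_default ?sQ ?subr0.
by have := monicP mQ; rewrite lead_coefE sQ eqxx /= => ->; rewrite subrr.
Qed.

Lemma restrict_shift (i j : 'I_(m + m)) : (j.+1 < m + m)%N ->
  restrict_mx block_shift i j = (i == j.+1 :> nat)%:R.
Proof.
move=> jm; rewrite !mxE eq_parity /= uphalf_half /block_shift.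
have hj := half_ord j.
case: (odd i); case oj: (odd j) => /=; rewrite ?mul0r ?rmod0p ?coef0 //.
  by rewrite mul1r rmodp_small ?size_polyXn ?sQ ?ltnS // coefXn.
rewrite -exprS rmodp_small ?coefXn ?add1n //.
rewrite size_polyXn sQ !ltnS -ltn_double doubleS -[m.*2]addnn.
by move: jm; rewrite -{1}(odd_double_half j) oj.
Qed.

Lemma restrict_shift_last (i j : 'I_(m + m)) : j.+1 = (m + m)%N ->
  restrict_mx block_shift i j = if odd i then 0 else - Q`_(i./2).
Proof.
move=> jm; rewrite !mxE.
have oj : odd j.
  by apply: negbFE; rewrite -[~~ _]/(odd j.+1) jm oddD addbb.
have hj : (j./2.+1 = m)%N.
  apply: double_inj; apply: etrans (etrans jm (addnn m)).
  by rewrite doubleS -[in RHS](odd_double_half j) oj.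
rewrite oj /block_shift; case: ifP => _; first by rewrite mul0r rmod0p coef0.
rewrite -exprS hj modXn_monic coefB coefXn ltn_eqF ?half_ord //.
by rewrite sub0r.
Qed.

End Restriction.

Section ColumnPoly.

Variables (A : comNzRingType) (m : nat).

(** The component on the basis vector b of the column c, as a polynomial in z.
    The indices are plain numbers, so that the definition is uniform in m. *)
Definition column_poly (b : bool) (c : nat) (M : 'M[A]_(m + m)) : {poly A} :=
  \poly_(l < m) \sum_(i < m + m | i == (b + l.*2)%N :> nat)
                \sum_(j < m + m | j == c :> nat) M i j.

Lemma size_column_poly b c M : (size (column_poly b c M) <= m)%N.
Proof. exact: size_poly. Qed.

Lemma coef_column_poly (M : 'M[A]_(m + m)) (i j : 'I_(m + m)) :
  (column_poly (odd i) j M)`_(i./2) = M i j.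
Proof.
rewrite coef_poly half_ord odd_double_half.
by rewrite (big_pred1 i) ?(big_pred1 j).
Qed.

Lemma column_polyP (M : 'M[A]_(m + m)) b (j : 'I_(m + m)) (p : {poly A}) :
  (size p <= m)%N ->
  (forall i : 'I_(m + m), odd i = b -> M i j = p`_(i./2)) ->
  column_poly b j M = p.
Proof.
move=> sp Mp; apply/polyP => l.
have [lm|ml] := ltnP l m; last first.
  by rewrite !nth_default ?(leq_trans _ ml) ?size_poly.
have i_lt : (b + l.*2 < m + m)%N.
  by rewrite addnn -ltn_half_double half_bit_double.
have := coef_column_poly M (Ordinal i_lt) j.
have ob : odd (Ordinal i_lt) = b by rewrite /= oddD odd_double oddb addbF.
by rewrite (Mp _ ob) ob /= half_bit_double.
Qed.

End ColumnPoly.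

Lemma map_column_poly (A B : comNzRingType) (f : {rmorphism A -> B}) m b c
    (M : 'M[A]_(m + m)) :
  map_poly f (column_poly b c M) = column_poly b c (map_mx f M).
Proof.
apply/polyP => l; rewrite coef_map !coef_poly.
case: ifP => _; last exact: rmorph0.
apply: etrans (rmorph_sum f _ _ _) _; apply: eq_bigr => i _.
apply: etrans (rmorph_sum f _ _ _) _.
by apply: eq_bigr => j _; rewrite mxE.
Qed.

(** * Companion matrices that are sums of two square roots of scalars *)

Section CompanionTrace.

Variables (A : comNzRingType) (n : nat) (S : 'M[A]_n).
Hypothesis S_companion :
  forall i j : 'I_n, (j.+1 < n)%N -> S i j = (i == j.+1 :> nat)%:R.

Lemma mulmx_exp t u : S ^+ t *m S ^+ u = S ^+ (t + u).
Proof. exact/esym/exprD. Qed.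

Definition unit_col (j : nat) : 'cV[A]_n := \col_i (i == j :> nat)%:R.

Lemma mulmx_unit_col (M : 'M[A]_n) (j i : 'I_n) : (M *m unit_col j) i 0 = M i j.
Proof.
rewrite mxE (bigD1 j) //= mxE eqxx mulr1 big1 ?addr0 // => l lj.
by rewrite mxE [_ == _](negPf lj) mulr0.
Qed.

Lemma companion_unit_col j : (j.+1 < n)%N -> S *m unit_col j = unit_col j.+1.
Proof.
move=> jn; apply/colP => i.
by rewrite (mulmx_unit_col S (Ordinal (ltnW jn))) S_companion // mxE.
Qed.

Lemma companion_exp_unit_col t j : (j + t < n)%N ->
  S ^+ t *m unit_col j = unit_col (j + t).
Proof.
elim: t => [|t IHt]; first by rewrite addn0 expr0 mul1mx.
rewrite addnS => jt.
by rewrite exprS -mulmxA IHt ?(ltnW jt) // companion_unit_col.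
Qed.

(** The coefficients of the characteristic polynomial of S. *)
Definition companion_coef (j : nat) : A :=
  if (j < n)%N then - \sum_(i < n | i == j :> nat)
                       \sum_(l < n | l.+1 == n :> nat) S i l
  else (j == n)%:R.

Lemma companion_coefE (i l : 'I_n) : l.+1 = n -> companion_coef i = - S i l.
Proof.
move=> ln; rewrite /companion_coef ltn_ord; congr (- _).
rewrite (big_pred1 i) ?(big_pred1 l) //= => l'.
apply/eqP/eqP => [E|-> //]; apply: val_inj; apply: succn_inj.
exact: etrans E (esym ln).
Qed.

Lemma companion_coef_n : companion_coef n = 1.
Proof. by rewrite /companion_coef ltnn eqxx. Qed.

Hypothesis n_gt0 : (0 < n)%N.

(** The Cayley-Hamilton theorem at the cyclic vector. *)
Lemma companion_annihilates :
  \sum_(j < n.+1) companion_coef j *: (S ^+ j *m unit_col 0) = 0.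
Proof.
have ln : (n.-1 < n)%N by rewrite prednK.
pose l := Ordinal ln; have lE : l.+1 = n by rewrite /= prednK.
rewrite big_ord_recr /= companion_coef_n scale1r.
have -> : S ^+ n *m unit_col 0 = \col_i S i l.
  have -> : S ^+ n = S ^+ l.+1 by rewrite lE.
  rewrite exprS -mulmxA companion_exp_unit_col // add0n.
  by apply/colP => i; rewrite mulmx_unit_col mxE.
apply/colP => i; rewrite !mxE summxE (bigD1 i) //= big1 => [|j ji].
  rewrite companion_exp_unit_col ?add0n // !mxE eqxx mulr1.
  by rewrite (companion_coefE _ lE) addr0 addNr.
rewrite companion_exp_unit_col ?add0n // !mxE.
by rewrite eq_sym [_ == _](negPf ji) mulr0.
Qed.

(** Newton's identities.  The left-hand side is the trace of the matrix B
    obtained by evaluating at S the polynomial part of chi / s ^ (k + 1), where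
    chi is the characteristic polynomial.  On the cyclic basis, B sends e_i to a
    combination whose i-th coordinate is the leading term c_(k + 1) if i <= k.
    If i > k, this coordinate is 0, because s ^ (k + 1) B is, up to sign, the
    part of chi of degree at most k. *)
Lemma companion_newton k : (k < n)%N ->
  \sum_(t < n - k) companion_coef (k.+1 + t) * \tr (S ^+ t) =
  companion_coef k.+1 *+ k.+1.
Proof.
move=> kn; pose B := \sum_(t < n - k) companion_coef (k.+1 + t) *: S ^+ t.
transitivity (\tr B).
  by rewrite raddf_sum; apply: eq_bigr => t _; rewrite /= mxtraceZ.
have BE (i : 'I_n) : B i i = if (i <= k)%N then companion_coef k.+1 else 0.
  rewrite -mulmx_unit_col /B mulmx_suml; case: leqP => [ik|ki].
    have nk : (0 < n - k)%N by rewrite subn_gt0.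
    rewrite summxE (bigD1 (Ordinal nk)) //= addn0 big1 ?addr0 => [|t t0].
      by rewrite expr0 -scalemxAl mul1mx !mxE eqxx mulr1.
    rewrite -scalemxAl companion_exp_unit_col; last first.
      by rewrite (leq_ltn_trans (leq_add ik (leqnn t))) // -ltn_subRL.
    rewrite !mxE -{1}[val i]addn0 eqn_add2l eq_sym [_ == _](_ : _ = false).
      by rewrite mulr0.
    by apply/negP => /eqP t00; case/eqP: t0; apply: val_inj.
  pose r := (i - k.+1)%N; have iE : i = (k.+1 + r)%N :> nat by rewrite subnKC.
  pose term j := companion_coef j *: (S ^+ j *m unit_col 0).
  have E0 : \sum_(t < n - k) term (k.+1 + t)%N = - \sum_(j < k.+1) term j.
    apply/eqP; rewrite -addr_eq0 addrC -[X in _ == X]companion_annihilates.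
    rewrite -!(big_mkord xpredT term).
    rewrite (@big_cat_nat _ _ _ k.+1 0 n.+1) //=; last by rewrite ltnS ltnW.
    apply/eqP; congr (_ + _).
    rewrite -[X in \sum_(X <= _ < _) _]add0n big_addn subSS big_mkord.
    by apply: eq_bigr => t _; rewrite addnC.
  have -> : \sum_(t < n - k)
        (companion_coef (k.+1 + t) *: S ^+ t) *m unit_col i =
      S ^+ r *m \sum_(t < n - k) term (k.+1 + t)%N.
    rewrite mulmx_sumr; apply: eq_bigr => t _.
    rewrite -scalemxAl -scalemxAr; congr (_ *: _).
    rewrite -[X in unit_col X]add0n -companion_exp_unit_col ?add0n //.
    by rewrite !mulmxA !mulmx_exp iE; congr (S ^+ _ *m _); lia.
  rewrite E0 mulmxN mxE mulmx_sumr summxE big1 ?oppr0 // => j _.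
  rewrite -scalemxAr mulmxA mulmx_exp companion_exp_unit_col add0n.
    rewrite !mxE [_ == _](_ : _ = false) ?mulr0 //; apply/eqP => iE'.
    by have := ltn_ord j; rewrite -(ltn_add2l r) -iE' iE addnC ltnn.
  rewrite (leq_ltn_trans _ (ltn_ord i)) // iE addnC leq_add2r.
  exact: ltnW.
rewrite /mxtrace (eq_bigr _ (fun i _ => BE i)) -big_mkcond sumr_const /=.
congr (_ *+ _).
rewrite -[RHS]card_ord -!sum1_card.
rewrite -(big_mkord (fun i => i <= k)%N (fun=> 1%N)).
rewrite -(big_mkord xpredT (fun=> 1%N)).
by rewrite [RHS](big_nat_widen _ _ n).
Qed.

Hypothesis torsA : natr_torsion_free A.
Hypothesis n_even : ~~ odd n.
Hypothesis tr_odd : forall t, odd t -> \tr (S ^+ t) = 0.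

(** Descending induction on j.  In Newton's identity for an odd coefficient all
    terms vanish except those with t = 0, which leaves (n - j) c_j = 0. *)
Lemma companion_coef_odd j : odd j -> companion_coef j = 0.
Proof.
have [p] := ubnP (n - j); elim: p j => // p IHp j.
rewrite ltnS => njp oj.
have [jn|nj|jn] := ltngtP j n; first 1 last.
- by rewrite /companion_coef ltnNge (ltnW nj) /= gtn_eqF.
- by move: n_even; rewrite -jn oj.
case: j => // k in njp oj jn *.
have := companion_newton (ltnW jn).
have nk : (0 < n - k)%N by rewrite subn_gt0 ltnW.
rewrite (bigD1 (Ordinal nk)) //= addn0 expr0 mxtrace1 mulr_natr big1 => [|t t0].
  rewrite addr0 => E; apply: (torsA (j := (n - k.+1).-1)).
  by rewrite prednK ?subn_gt0 // mulrnBr ?(ltnW jn) // E subrr.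
have [ot|et] := boolP (odd t); first by rewrite tr_odd ?mulr0.
rewrite IHp ?mul0r //.
  have t_gt0 : (0 < t)%N.
    by rewrite lt0n; apply/eqP => t00; case/eqP: t0; apply: val_inj.
  by rewrite (leq_trans _ njp) // ltn_sub2l // -addn1 leq_add2l.
by rewrite oddD oj (negPf et).
Qed.

End CompanionTrace.

Section SumOfSquareRoots.

Variables (A : comNzRingType) (n : nat).
Implicit Types (M N : 'M[A]_n) (a b : A).

Lemma sqr_sum M N a b : M *m M = a%:M -> N *m N = b%:M ->
  (M + N) *m (M + N) = (a + b)%:M + (M *m N + N *m M).
Proof.
move=> MM NN; rewrite mulmxDl !mulmxDr MM NN raddfD /=.
by rewrite [N *m M + _]addrC addrACA.
Qed.

(** By the preceding expansion, the square of the sum is a scalar plus the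
    anticommutator of M and N, which commutes with both. *)
Lemma comm_sqr_sum M N a b : M *m M = a%:M -> N *m N = b%:M ->
  M *m ((M + N) *m (M + N)) = ((M + N) *m (M + N)) *m M.
Proof.
move=> MM NN; rewrite (sqr_sum MM NN) mulmxDr mulmxDl scalar_mxC.
congr (_ + _); rewrite mulmxDr mulmxDl !mulmxA MM -[N *m M *m M]mulmxA MM.
by rewrite scalar_mxC addrC.
Qed.

(** Moving a factor X cyclically past Y gives
    tr (X (X Y + Y X) Z) = 2 X ^ 2 tr (Y Z) when X ^ 2 is scalar and Z commutes
    with X.  This lowers the exponent of the square of the sum. *)
Lemma trace_mul_sqr_sum M N a b k : M *m M = a%:M -> N *m N = b%:M ->
  \tr M = 0 -> \tr N = 0 ->
  \tr (M *m ((M + N) *m (M + N)) ^+ k) = 0 /\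
  \tr (N *m ((M + N) *m (M + N)) ^+ k) = 0.
Proof.
move=> MM NN trM trN; have cM := comm_sqr_sum MM NN.
have cN : N *m ((M + N) *m (M + N)) = ((M + N) *m (M + N)) *m N.
  by rewrite [M + N]addrC; apply: comm_sqr_sum NN MM.
have SS := sqr_sum MM NN; set Z := (M + N) *m (M + N) in cM cN SS *.
(* The square of the sum is made opaque, so that only its expansion SS and its
   commutation with M and N are available below. *)
move: Z cM cN SS => Z cM cN SS.
have step X Y c (XX : X *m X = c%:M) (XZ : X *m Z = Z *m X) j :
    \tr (X *m (X *m Y + Y *m X) *m Z ^+ j) = 2 * c * \tr (Y *m Z ^+ j).
  have XZj : X *m Z ^+ j = Z ^+ j *m X.
    elim: j => [|j IHj]; first by rewrite expr0 mulmx1 mul1mx.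
    by rewrite exprS -[Z * _]/(Z *m _) mulmxA XZ -mulmxA IHj mulmxA.
  rewrite mulmxDr mulmxA XX mul_scalar_mx mulmxDl raddfD /= -scalemxAl mxtraceZ.
  have -> : \tr (X *m (Y *m X) *m Z ^+ j) = c * \tr (Y *m Z ^+ j).
    rewrite -[_ *m _ *m Z ^+ j]mulmxA mxtrace_mulC -!mulmxA -XZj.
    by rewrite (mulmxA X X) XX mul_scalar_mx -scalemxAr mxtraceZ.
  by ring.
elim: k => [|k [IHM IHN]]; first by rewrite expr0 !mulmx1.
have MZ : M *m Z = (a + b) *: M + M *m (M *m N + N *m M).
  by rewrite SS [LHS]mulmxDr mul_mx_scalar.
have NZ : N *m Z = (a + b) *: N + N *m (N *m M + M *m N).
  by rewrite SS [LHS]mulmxDr mul_mx_scalar [N *m M + _]addrC.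
rewrite exprS -[Z * _]/(Z *m _) !mulmxA MZ NZ.
rewrite !mulmxDl !mxtraceD -!scalemxAl !mxtraceZ IHM IHN !mulr0 !add0r.
by rewrite (step M N a) ?(step N M b) // IHM IHN !mulr0.
Qed.

Lemma trace_odd_sum M N a b t : M *m M = a%:M -> N *m N = b%:M ->
  \tr M = 0 -> \tr N = 0 -> odd t -> \tr ((M + N) ^+ t) = 0.
Proof.
move=> MM NN trM trN ot; rewrite -(odd_double_half t) ot -muln2 mulnC.
rewrite exprS exprM expr2 -[(M + N) * _]/((M + N) *m _) mulmxDl raddfD /=.
have [HM HN] := trace_mul_sqr_sum t./2 MM NN trM trN.
by rewrite [X in X + _]HM add0r HN.
Qed.

End SumOfSquareRoots.

(** * Normal form of the pairs of matrices *)

Lemma map_D2_surface (k : fieldType) (mu1 mu2 : k) (B : comNzRingType)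
    (f : {rmorphism k -> B}) :
  map_mpoly f (D2_surface mu1 mu2) =
  'X_ord_a ^+ 2 - 'X_ord_x * 'X_ord_c ^+ 2 + f 4^-1 *: 'X_ord_x
    + f (mu1 ^+ 2 - mu2 ^+ 2) *: 'X_ord_c
    - (f (2^-1 * (mu1 ^+ 2 + mu2 ^+ 2)))%:MP.
Proof.
rewrite /D2_surface (rmorphB (map_mpoly f)) !(rmorphD (map_mpoly f)).
rewrite (rmorphN (map_mpoly f)) (rmorphXn (map_mpoly f)).
rewrite (rmorphM (map_mpoly f)) (rmorphXn (map_mpoly f)) /=.
rewrite !map_mpolyZ map_mpolyC.
by rewrite !map_mpolyX.
Qed.

Section MatrixPairs.

Variables (k : fieldType) (m : nat) (mu1 mu2 : k) (A : comAlgType k).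
Hypotheses (k0 : [pchar k] =i pred0) (m_gt0 : (0 < m)%N).
Hypotheses (mu10 : mu1 != 0) (mu20 : mu2 != 0).

Let a1 : A := (mu1 ^+ 2)%:A.
Let a2 : A := (mu2 ^+ 2)%:A.
Let h : A := (2^-1)%:A.

(** The equation of the surface on the curve x |-> (al x, ga x, x). *)
Definition surface_value (al ga : {poly A}) : {poly A} :=
  graph_eval al ga (map_mpoly (in_alg A) (D2_surface mu1 mu2)).

Lemma two_half : h + h = 1.
Proof.
rewrite /h -scalerDl -mulr2n -(mulr_natl (2^-1 : k)) mulfV ?scale1r //.
by rewrite (proj1 (pcharf0P k) k0).
Qed.

Lemma surface_valueE al ga :
  surface_value al ga = al ^+ 2 - 'X * ga ^+ 2 + (h * h)%:P * 'X
    + (a1 - a2)%:P * ga - (h * (a1 + a2))%:P.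
Proof.
have hh : h * h = in_alg A 4^-1.
  rewrite /h -scalerAl mul1r scalerA -invfM; congr (_^-1 *: _).
  by rewrite -natrM.
have ad : a1 - a2 = in_alg A (mu1 ^+ 2 - mu2 ^+ 2) by rewrite rmorphB.
have ha : h * (a1 + a2) = in_alg A (2^-1 * (mu1 ^+ 2 + mu2 ^+ 2)).
  by rewrite rmorphM rmorphD.
rewrite hh ad ha /surface_value (map_D2_surface mu1 mu2 (in_alg A)).
rewrite (rmorphB (graph_eval al ga)) !(rmorphD (graph_eval al ga)).
rewrite (rmorphN (graph_eval al ga)) (rmorphXn (graph_eval al ga)).
rewrite (rmorphM (graph_eval al ga)) (rmorphXn (graph_eval al ga)) /=.
by rewrite !graph_evalZ graph_evalC !graph_eval_var /= -!mul_polyC.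
Qed.

(** The matrix with first column (al, be) whose anticommutator with s is the
    scalar z + mu1 ^ 2 - mu2 ^ 2. *)
Definition pair_block (al be : {poly A}) : bool -> bool -> {poly A} :=
  fun a b => if a then (if b then - al else be)
             else (if b then 'X + (a1 - a2)%:P - 'X * be else al).

(** The left-hand side is the square of the block matrix.  The substitution
    be = c + 1/2 completes the square: - z be ^ 2 + z be = - z c ^ 2 + z / 4. *)
Lemma pair_block_sqr al be :
  al * al + ('X + (a1 - a2)%:P - 'X * be) * be =
  a1%:P + surface_value al (be - h%:P).
Proof.
rewrite surface_valueE !(polyCD, polyCN, polyCM).
set u := h%:P; set v := a1%:P; set w := a2%:P.
have uu : 1 - (u + u) = 0 by rewrite -polyCD two_half subrr.
apply/eqP; rewrite -subr_eq0; apply/eqP.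
transitivity ((1 - (u + u)) * ('X * be - v)); first by ring.
by rewrite uu mul0r.
Qed.

(** For a companion matrix S with even characteristic polynomial Q (s ^ 2), this
    is Q: the even rows of the last column hold the coefficients of -Q. *)
Definition pair_modulus (S : 'M[A]_(m + m)) : {poly A} :=
  'X^m - column_poly false (m + m).-1 S.

Lemma size_pair_modulus S : size (pair_modulus S) = m.+1.
Proof.
by rewrite size_polyDl ?size_polyXn // size_polyN ltnS size_column_poly.
Qed.

Lemma pair_modulus_monic S : pair_modulus S \is monic.
Proof.
rewrite monicE lead_coefE size_pair_modulus coefB coefXn eqxx.
by rewrite nth_default ?subr0 // size_column_poly.
Qed.

Section NormalForm.

Variables (Q al be : {poly A}).
Hypotheses (mQ : Q \is monic) (sQ : size Q = m.+1).

Let W := restrict_mx m Q (pair_block al be).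
Let J := restrict_mx m Q (block_shift A).

Lemma restrict_shift_sqr : J *m J = restrict_mx m Q (block_diag 'X).
Proof.
rewrite restrict_mxM //; apply: eq_restrict_mx => // a b.
by case: a; case: b; rewrite /block_mul /block_diag /=; congr rmodp; ring.
Qed.

Lemma pair_block_anticomm : W *m J + J *m W = J *m J + (a1 - a2)%:M.
Proof.
rewrite restrict_shift_sqr -(restrict_mx_scalar sQ) !restrict_mxM //.
rewrite !restrict_mxD //; apply: eq_restrict_mx => // a b.
by case: a; case: b; rewrite /block_mul /block_diag /pair_block /=;
   congr rmodp; ring.
Qed.

Lemma pair_block_mx_sqr :
  W *m W = a1%:M + restrict_mx m Q (block_diag (surface_value al (be - h%:P))).
Proof.
rewrite -(restrict_mx_scalar sQ) restrict_mxM // restrict_mxD //.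
apply: eq_restrict_mx => // a b.
by case: a; case: b;
   rewrite /block_mul /block_diag /pair_block /= -?pair_block_sqr;
   congr rmodp; ring.
Qed.

(** Both squares are scalar modulo the equation of the surface: the second one
    follows from the first by the anticommutation with s. *)
Lemma restrict_pair_D2 :
  rmodp (surface_value al (be - h%:P)) Q = 0 ->
  D2_points mu1 mu2 (W, J - W).
Proof.
move=> FQ.
have F0 : restrict_mx m Q (block_diag (surface_value al (be - h%:P))) = 0.
  rewrite -[RHS](raddf0 (@scalar_mx A (m + m))) /= -(restrict_mx_scalar sQ).
  apply: eq_restrict_mx => // a b; rewrite /block_diag.
  by case: (a == b) => //; rewrite FQ rmod0p.
have WW : W *m W = a1%:M by rewrite pair_block_mx_sqr F0 addr0.
have trW : \tr W = 0 by apply: restrict_mx_tr.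
have trJ : \tr J = 0 by apply: restrict_mx_tr; rewrite //= oppr0.
split=> /=.
- exact: sqr_tr_orbit_points.
- apply: sqr_tr_orbit_points => //; last by rewrite raddfB /= trJ trW subrr.
  have -> : (J - W) *m (J - W) = J *m J - (W *m J + J *m W) + W *m W.
    rewrite mulmxBl !mulmxBr opprB opprD !addrA [LHS]addrAC.
    by congr (_ + _); apply: addrAC.
  rewrite pair_block_anticomm WW opprD addrA subrr add0r raddfB /= opprB.
  by rewrite subrK.
- by rewrite addrC subrK => i j; apply: restrict_shift.
Qed.

Lemma column_poly_pair_block b : (size al <= m)%N -> (size be <= m)%N ->
  column_poly b 0 W = if b then be else al.
Proof.
move=> sal sbe; have j_lt : (0 < m + m)%N by rewrite addn_gt0 m_gt0.
apply: (@column_polyP _ _ _ _ (Ordinal j_lt)); first by case: b.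
move=> i ib; rewrite mxE ib expr0 mulr1 rmodp_small; first by case: b {ib}.
by rewrite sQ ltnS; case: b {ib}.
Qed.

Lemma pair_modulus_shift : pair_modulus J = Q.
Proof.
have j_lt : ((m + m).-1 < m + m)%N by rewrite prednK ?addn_gt0 ?m_gt0.
have jE : (Ordinal j_lt).+1 = (m + m)%N by rewrite /= prednK ?addn_gt0 ?m_gt0.
rewrite /pair_modulus (@column_polyP _ _ _ _ (Ordinal j_lt) ('X^m - Q)).
- by rewrite opprB addrC subrK.
- by rewrite -ltnS -sQ -modXn_monic // ltn_rmodp monic_neq0.
- move=> i oi; rewrite restrict_shift_last // oi coefB coefXn.
  by rewrite ltn_eqF ?half_ord // sub0r.
Qed.

End NormalForm.

(** The sum S is the companion matrix of Q (s ^ 2) because its characteristic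
    polynomial is even.  Then M.1 and the block matrix have the same
    anticommutator with S and the same first column, so they agree on the cyclic
    basis, and the square of M.1 gives the equation of the surface. *)
Lemma D2_normal_form M (Q := pair_modulus (M.1 + M.2))
    (al := column_poly false 0 M.1) (be := column_poly true 0 M.1) :
  D2_points mu1 mu2 M ->
  [/\ M.1 = restrict_mx m Q (pair_block al be),
      M.1 + M.2 = restrict_mx m Q (block_shift A)
    & rmodp (surface_value al (be - h%:P)) Q = 0].
Proof.
case: M => M N /= in Q al be * => -[/= orbM orbN comp].
have [MM trM] := orbit_points_sqr_tr orbM.
have [NN trN] := orbit_points_sqr_tr orbN.
rewrite -/a1 in MM; rewrite -/a2 in NN.
have mQ : Q \is monic by apply: pair_modulus_monic.
have sQ : size Q = m.+1 by apply: size_pair_modulus.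
have n_gt0 : (0 < m + m)%N by rewrite addn_gt0 m_gt0.
have l_lt : ((m + m).-1 < m + m)%N by rewrite prednK.
pose l := Ordinal l_lt; have lE : l.+1 = (m + m)%N by rewrite /= prednK.
have SJ : M + N = restrict_mx m Q (block_shift A).
  apply/matrixP => i j.
  have [jn|nj] := ltnP j.+1 (m + m); first by rewrite comp // restrict_shift.
  have -> : j = l.
    by apply: val_inj; apply/eqP; rewrite -eqSS lE eqn_leq nj ltn_ord.
  rewrite restrict_shift_last //; case: ifPn => oi; last first.
    rewrite coefB coefXn ltn_eqF ?half_ord // sub0r opprK.
    by rewrite -(negPf oi) (coef_column_poly _ i l).
  apply/eqP; rewrite -oppr_eq0 -(companion_coefE _ _ lE); apply/eqP.
  apply: (companion_coef_odd comp n_gt0) => //.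
  - exact: alg_torsion_free.
  - by rewrite oddD addbb.
  - by move=> t; apply: trace_odd_sum MM NN trM trN.
have anti : M *m (M + N) + (M + N) *m M = (M + N) *m (M + N) + (a1 - a2)%:M.
  rewrite (sqr_sum MM NN) mulmxDr mulmxDl MM addrACA [RHS]addrAC.
  by congr (_ + _); rewrite -!(raddfD (@scalar_mx A _)) /=; congr (_%:M); ring.
have ME : M = restrict_mx m Q (pair_block al be).
  (* D anticommutes with S and kills e_0, hence kills every S ^ j e_0. *)
  pose D := M - restrict_mx m Q (pair_block al be).
  have DS : D *m (M + N) = - ((M + N) *m D).
    apply/eqP; rewrite -addr_eq0 mulmxBl mulmxBr addrACA -opprD anti.
    by rewrite SJ pair_block_anticomm // subrr.
  have D0 j : (j < m + m)%N -> D *m unit_col A (m + m) j = 0.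
    elim: j => [|j IHj] jn.
      apply/colP => i; rewrite (mulmx_unit_col D (Ordinal n_gt0)) !mxE.
      rewrite -(coef_column_poly M i (Ordinal n_gt0)) /= expr0 mulr1.
      rewrite rmodp_small; last first.
        by rewrite sQ ltnS; case: (odd i); rewrite size_column_poly.
      by rewrite /pair_block; case: (odd i); rewrite subrr.
    rewrite -(companion_unit_col comp) // mulmxA DS mulNmx -mulmxA.
    by rewrite IHj ?(ltnW jn) // mulmx0 oppr0.
  apply/eqP; rewrite -subr_eq0; apply/eqP/matrixP => i j.
  by rewrite -/D -mulmx_unit_col D0 ?ltn_ord // !mxE.
split=> //.
apply: (restrict_mx_diag0 mQ sQ).
have := pair_block_mx_sqr al be mQ sQ; rewrite -ME MM.
by move/eqP; rewrite -[X in X == _]addr0 (inj_eq (addrI _)) => /eqP.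
Qed.

End MatrixPairs.

(** * The isomorphism *)

Section Isomorphism.

Variables (k : fieldType) (m : nat) (mu1 mu2 : k).
Hypotheses (k0 : [pchar k] =i pred0) (m_gt0 : (0 < m)%N).
Hypotheses (mu10 : mu1 != 0) (mu20 : mu2 != 0).

(** The coordinate c is be - 1/2, see pair_block_sqr. *)
Definition pair_to_scheme (A : comAlgType k)
    (M : 'M[A]_(m + m) * 'M[A]_(m + m)) : set {mpoly A[3]} :=
  graph_ideal (pair_modulus (M.1 + M.2)) (column_poly false 0 M.1)
    (column_poly true 0 M.1 - ((2^-1)%:A)%:P).

Lemma size_half_shift (A : comAlgType k) (p : {poly A}) :
  (size p <= m)%N -> (size (p - ((2^-1)%:A)%:P)%R <= m)%N.
Proof.
move=> sp; rewrite (leq_trans (size_polyD _ _)) // geq_max sp size_polyN.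
exact: leq_trans (size_polyC_leq1 _) m_gt0.
Qed.

(** Injectivity and surjectivity both come from the normal form: the triple
    (Q, al, be) determines the pair of matrices, and every triple on the surface
    is realised by the block matrices. *)
Lemma pair_to_scheme_bij (A : comAlgType k) :
  set_bij (@D2_points k m mu1 mu2 A)
    (@transverse_hilbert_points k 3 (D2_surface mu1 mu2) (Xx k) m A)
    (@pair_to_scheme A).
Proof.
split.
- move=> M /(D2_normal_form k0 m_gt0)[_ _ FQ].
  apply: graph_ideal_transverse; first exact: pair_modulus_monic.
    exact: size_pair_modulus.
  exact: FQ.
- move=> M N /set_mem DM /set_mem DN E.
  have [M1 MS _] := D2_normal_form k0 m_gt0 DM.
  have [N1 NS _] := D2_normal_form k0 m_gt0 DN.
  have [EQ Eal /addIr Ebe] := graph_ideal_inj (pair_modulus_monic _)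
    (pair_modulus_monic _) (size_pair_modulus _) (size_pair_modulus _)
    (size_column_poly _ _ _) (size_column_poly _ _ _)
    (size_half_shift (size_column_poly _ _ _))
    (size_half_shift (size_column_poly _ _ _)) E.
  have E1 : M.1 = N.1 by rewrite M1 N1 EQ Eal Ebe.
  have ES : M.1 + M.2 = N.1 + N.2 by rewrite MS NS EQ.
  have E2 : M.2 = N.2 by move: ES; rewrite E1 => /addrI.
  by rewrite (surjective_pairing M) E1 E2 -surjective_pairing.
- move=> I TI.
  have [Q [al [ga [mQ sQ sal sga IE]]]] := transverse_graph_ideal TI.
  pose be := ga + ((2^-1)%:A)%:P.
  have sbe : (size be <= m)%N.
    rewrite (leq_trans (size_polyD _ _)) // geq_max sga.
    exact: leq_trans (size_polyC_leq1 _) m_gt0.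
  pose W := restrict_mx m Q (pair_block mu1 mu2 al be).
  pose J := restrict_mx m Q (block_shift A).
  exists (W, J - W).
    apply: restrict_pair_D2 => //; rewrite addrK.
    by have [[_ IF _] _] := TI; rewrite IE in IF; apply: IF.
  rewrite /pair_to_scheme /= [W + _]addrC subrK pair_modulus_shift //.
  by rewrite !column_poly_pair_block // addrK.
Qed.

(** The three polynomials are read off the entries of the matrices. *)
Lemma pair_to_scheme_base_change (A B : comAlgType k) (f : {lrmorphism A -> B})
    (M : 'M[A]_(m + m) * 'M[A]_(m + m)) :
  pair_to_scheme (map_pair_mx f M) = base_change f (pair_to_scheme M).
Proof.
rewrite base_change_graph_ideal; last exact: pair_modulus_monic.
rewrite /pair_to_scheme /pair_modulus /= !rmorphB /= map_polyXn map_polyC /=.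
by rewrite linearZ /= rmorph1 !map_column_poly map_mxD.
Qed.

End Isomorphism.

Theorem corollary7p2 (R : realType) (m : nat) (mu1 mu2 : R[i])
    (m_ge1 : (1 <= m)%N) (mu1_neq0 : mu1 != 0) (mu2_neq0 : mu2 != 0) :
  exists phi : forall A : comAlgType R[i],
      'M[A]_(m + m) * 'M[A]_(m + m) -> set {mpoly A[3]},
    (forall A : comAlgType R[i],
       set_bij (@D2_points R[i] m mu1 mu2 A)
         (@transverse_hilbert_points R[i] 3
            (D2_surface mu1 mu2) (Xx R[i]) m A)
         (phi A)) /\
    (forall (A B : comAlgType R[i]) (f : {lrmorphism A -> B})
        (M : 'M[A]_(m + m) * 'M[A]_(m + m)),
       @D2_points R[i] m mu1 mu2 A M ->
       phi B (map_pair_mx f M) = base_change f (phi A M)).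
Proof.
exists (@pair_to_scheme R[i] m); split.
  move=> A; apply: pair_to_scheme_bij => //.
  exact: Num.Theory.pchar_num.
by move=> A B f M _; apply: pair_to_scheme_base_change.
Qed.
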